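(* Let $v,a,b,c\in\mathbb{C}$ with $\Re(v)<3$, $\Re(c)>0$, and $\Re(vc+a+b)>0$, $\Re(vc+a-b)>0$, $\Re(vc-a+b)>0$, $\Re(vc-a-b)>0$. Put $\sigma_3=\frac v2-\frac{a}{2c}-\frac{b}{2c}$, $\sigma_4=\frac v2-\frac{a}{2c}+\frac{b}{2c}$, $\sigma_5=\frac v2+\frac{a}{2c}+\frac{b}{2c}$, $\sigma_6=\frac v2+\frac{a}{2c}-\frac{b}{2c}$, $P=(vc-a-b)(vc+a+b)(vc-a+b)(vc+a-b)$, and assume $\frac v2\notin\mathbb{Z}_0^-$, $1+\sigma_j\notin\mathbb{Z}_0^-$ ($j=3,4,5,6$). Then $$ \int_0^\infty\frac{\sinh(ax)\sinh(bx)}{\sinh^{v}(cx)}\,dx=\frac{2^{v+1}\,v\,a\,b\,c}{P}\;{}_6F_5\!\left(\begin{matrix}v,\ 1+\frac v2,\ \sigma_3,\ \sigma_5,\ \sigma_4,\ \sigma_6\\ \frac v2,\ 1+\sigma_3,\ 1+\sigma_5,\ 1+\sigma_4,\ 1+\sigma_6\end{matrix};\,1\right). $$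
   Context: $\mathbb{Z}_0^-=\{0,-1,-2,\dots\}$. The Pochhammer symbol is $(\lambda)_0=1$, $(\lambda)_n=\lambda(\lambda+1)\cdots(\lambda+n-1)$ for $n\ge1$. The generalized hypergeometric series is ${}_pF_q\!\left(\begin{matrix}\alpha_1,\dots,\alpha_p\\ \beta_1,\dots,\beta_q\end{matrix};z\right)=\sum_{n=0}^\infty\frac{(\alpha_1)_n\cdots(\alpha_p)_n}{(\beta_1)_n\cdots(\beta_q)_n}\frac{z^n}{n!}$ (with no $\beta_j\in\mathbb{Z}_0^-$); when $p=q+1$ and $z=1$ it converges if $\Re(\sum\beta_j-\sum\alpha_i)>0$. For $\Re(c)>0$ and $x>0$, the complex power $\sinh^{v}(cx)$ means $2^{-v}e^{vcx}(1-e^{-2cx})^{v}$, with the principal branch of $(1-e^{-2cx})^{v}$ (this agrees with the ordinary real power when $c>0$ and $v$ is real). *)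

(* Defs.v *)
From Stdlib Require Import Reals Lra List Factorial.
Open Scope R_scope.

Record Cplx := mkC { Cre : R ; Cim : R }.

Definition RtoC (x : R) : Cplx := mkC x 0.
Definition Czero : Cplx := RtoC 0.
Definition Cone : Cplx := RtoC 1.
Definition Cadd (z w : Cplx) : Cplx := mkC (Cre z + Cre w) (Cim z + Cim w).
Definition Copp (z : Cplx) : Cplx := mkC (- Cre z) (- Cim z).
Definition Csub (z w : Cplx) : Cplx := Cadd z (Copp w).
Definition Cmul (z w : Cplx) : Cplx :=
  mkC (Cre z * Cre w - Cim z * Cim w) (Cre z * Cim w + Cim z * Cre w).
Definition Cnorm2 (z : Cplx) : R := Cre z * Cre z + Cim z * Cim z.
Definition Cinv (z : Cplx) : Cplx := mkC (Cre z / Cnorm2 z) (- Cim z / Cnorm2 z).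
Definition Cdiv (z w : Cplx) : Cplx := Cmul z (Cinv w).
Definition Cabs (z : Cplx) : R := sqrt (Cnorm2 z).

Definition Cexp (z : Cplx) : Cplx := mkC (exp (Cre z) * cos (Cim z)) (exp (Cre z) * sin (Cim z)).

Definition Carg (z : Cplx) : R :=
  let x := Cre z in let y := Cim z in
  match Rlt_dec 0 x with
  | left _ => atan (y / x)
  | right _ =>
    match Rlt_dec x 0 with
    | left _ => match Rle_dec 0 y with
                | left _ => atan (y / x) + PI
                | right _ => atan (y / x) - PI
                end
    | right _ =>
      match Rlt_dec 0 y with
      | left _ => PI / 2
      | right _ => match Rlt_dec y 0 with
                   | left _ => - (PI / 2)
                   | right _ => 0
                   end
      end
    end
  end.

Definition Clog (z : Cplx) : Cplx := mkC (ln (Cabs z)) (Carg z).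

(* principal power w^v = exp(v Log w) (w <> 0) *)
Definition Cpow (w v : Cplx) : Cplx := Cexp (Cmul v (Clog w)).

Definition Csinh (z : Cplx) : Cplx := Cmul (RtoC (1/2)) (Csub (Cexp z) (Cexp (Copp z))).

(* sinh^v(c x) := 2^{-v} e^{v c x} (1 - e^{-2 c x})^v, principal branch *)
Definition sinh_cpow (c v : Cplx) (x : R) : Cplx :=
  Cmul (Cexp (Cmul (Copp v) (RtoC (ln 2))))
    (Cmul (Cexp (Cmul v (Cmul c (RtoC x))))
          (Cpow (Csub Cone (Cexp (Cmul (RtoC (-2)) (Cmul c (RtoC x))))) v)).

Fixpoint Cpoch (a : Cplx) (n : nat) : Cplx :=
  match n with
  | O => Cone
  | S k => Cmul (Cpoch a k) (Cadd a (RtoC (INR k)))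
  end.

Fixpoint Cpown (z : Cplx) (n : nat) : Cplx :=
  match n with O => Cone | S k => Cmul (Cpown z k) z end.

Definition Cprod (l : list Cplx) : Cplx := fold_right Cmul Cone l.

Definition pFq_term (alphas betas : list Cplx) (z : Cplx) (n : nat) : Cplx :=
  Cdiv (Cmul (Cprod (map (fun a => Cpoch a n) alphas)) (Cpown z n))
       (Cmul (Cprod (map (fun b => Cpoch b n) betas)) (RtoC (INR (fact n)))).

Fixpoint Cpartial_sum (f : nat -> Cplx) (n : nat) : Cplx :=
  match n with
  | O => f O
  | S k => Cadd (Cpartial_sum f k) (f (S k))
  end.

Definition Cseries_cv (f : nat -> Cplx) (S : Cplx) : Prop :=
  Un_cv (fun n => Cre (Cpartial_sum f n)) (Cre S) /\
  Un_cv (fun n => Cim (Cpartial_sum f n)) (Cim S).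

Definition improper_integral_0_inf (f : R -> Cplx) (L : Cplx) : Prop :=
  (forall e T, 0 < e -> e <= T ->
     inhabited (Riemann_integrable (fun x => Cre (f x)) e T) /\
     inhabited (Riemann_integrable (fun x => Cim (f x)) e T)) /\
  (forall eps, 0 < eps -> exists delta, 0 < delta /\ exists M, forall e T
     (pr1 : Riemann_integrable (fun x => Cre (f x)) e T)
     (pr2 : Riemann_integrable (fun x => Cim (f x)) e T),
     0 < e -> e < delta -> M < T ->
     Rabs (RiemannInt pr1 - Cre L) < eps /\ Rabs (RiemannInt pr2 - Cim L) < eps).

Definition not_nonpos_int (z : Cplx) : Prop := forall n : nat, z <> RtoC (- INR n).

(* Main.v *)
(** Since [1 - e^{-2cx}] lies in the right half-plane, [sinh^{-v}(cx)] expands for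
    [x > 0] as [2^v sum_n (v)_n/n! e^{-(v+2n)cx}].  With [l_n = (v+2n)c], the term
    [4 sinh(ax) sinh(bx) e^{-l_n x}] has minus the primitive
    [G_n(x) = sum (+/-) e^{-(l_n -/+ a -/+ b)x} / (l_n -/+ a -/+ b)], which vanishes at
    infinity and whose value at [0] is [8 l_n a b / prod (l_n +/- a +/- b)], i.e. the
    hypergeometric term up to a constant.  The expansion converges uniformly only away
    from [0], but [|G_n(x)| <= K/((n+1)(n+2)(n+3))] for all [x >= 0], because the
    integrand is [O(x^2 e^{-kx})] with [k] of order [n]; as
    [sum_n |(v)_n/n!| / ((n+1)(n+2)(n+3))] converges when [Re v < 3], dominated
    convergence of the series of primitives handles both endpoints. *)

From Stdlib Require Import Reals Lra Lia List Factorial.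
From Coquelicot Require Import Rcomplements Rbar Lim_seq Hierarchy Continuity Derive AutoDerive RInt RInt_analysis Series ElemFct.
From Coquelicot Require Complex.
Require Import Defs.
Import ListNotations.
Open Scope R_scope.

(** * Calculus of complex-valued functions of a real variable *)

Declare Scope cplx_scope.
Delimit Scope cplx_scope with X.
Bind Scope cplx_scope with Cplx.
Local Infix "+" := Cadd : cplx_scope.
Local Infix "-" := Csub : cplx_scope.
Local Infix "*" := Cmul : cplx_scope.
Local Infix "/" := Cdiv : cplx_scope.
Local Notation "- z" := (Copp z) : cplx_scope.
Local Notation "0" := Czero : cplx_scope.
Local Notation "1" := Cone : cplx_scope.
#[local] Arguments Cabs z%_X.
#[local] Arguments Cre c%_X.
#[local] Arguments Cim c%_X.
#[local] Arguments Cexp z%_X.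
#[local] Arguments Clog z%_X.

(** The bound on [Re v] balances two rates: [(v)_n/n!] has size [n^(Re v - 1)] and [G_n] has size
    [n^(-3)]. The cubic decay is a cancellation: the four exponentials of [G_n] are each only
    [O(1/n)], and taking moduli separately loses it. It is therefore recovered from the integrand,
    where each sinh contributes a factor [x]. The binomial expansion for complex [v] is obtained by
    real calculus alone: along the segment [t w] with [t] in [[0, 1]], the truncated series times
    [(1 - t w)^v] is nearly constant. The value at 0 then has the same rate as [G_n], so one
    majorant serves both the primitives and the hypergeometric series. *)

Lemma Cplx_eq z w : Cre z = Cre w -> Cim z = Cim w -> z = w.
Proof. destruct z, w; simpl; intros; subst; reflexivity. Qed.

Lemma Cnorm2_pos z : z <> Czero -> 0 < Cnorm2 z.
Proof.
  destruct z as [x y]; unfold Cnorm2; simpl; intros H.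
  destruct (Req_dec x 0) as [->|Hx].
  - destruct (Req_dec y 0) as [->|Hy]; [now elim H|]. nra.
  - nra.
Qed.

Lemma Cplx_field_theory : field_theory Czero Cone Cadd Cmul Csub Copp Cdiv Cinv eq.
Proof.
  split; [split| | |]; intros; try reflexivity;
    try (apply Cplx_eq; simpl; ring).
  - intros H; apply (f_equal Cre) in H; simpl in H; lra.
  - apply Cnorm2_pos in H. unfold Cnorm2 in H.
    apply Cplx_eq; simpl; unfold Cnorm2; field; lra.
Qed.

Add Field Cplx_field : Cplx_field_theory.

Lemma Cabs_Cmod z : Cabs z = Complex.Cmod (Cre z, Cim z).
Proof. unfold Cabs, Cnorm2, Complex.Cmod; simpl; f_equal; ring. Qed.

Lemma Cabs_ge0 z : 0 <= Cabs z.
Proof. apply sqrt_pos. Qed.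

Lemma Cabs_add z w : Cabs (z + w)%X <= Cabs z + Cabs w.
Proof.
  rewrite !Cabs_Cmod; apply (Complex.Cmod_triangle (Cre z, Cim z) (Cre w, Cim w)).
Qed.

Lemma Cabs_mul z w : Cabs (z * w)%X = Cabs z * Cabs w.
Proof.
  unfold Cabs; rewrite <- sqrt_mult; unfold Cnorm2; simpl; try nra.
  f_equal; ring.
Qed.

Lemma Cabs_opp z : Cabs (- z)%X = Cabs z.
Proof. unfold Cabs, Cnorm2; simpl; f_equal; ring. Qed.

Lemma Cabs_RtoC x : Cabs (RtoC x) = Rabs x.
Proof. rewrite <- sqrt_Rsqr_abs; unfold Cabs, Cnorm2, Rsqr; simpl; f_equal; ring. Qed.

Lemma Cabs_inv z : z <> Czero -> Cabs (Cinv z) = / Cabs z.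
Proof.
  intros H.
  assert (E : Cabs (Cinv z) * Cabs z = 1).
  { rewrite <- Cabs_mul. replace (Cinv z * z)%X with (RtoC 1) by (change (RtoC 1) with Cone; field; exact H).
    rewrite Cabs_RtoC; apply Rabs_R1. }
  assert (Cabs z <> 0) by (intros E'; rewrite E' in E; lra).
  apply (Rmult_eq_reg_r (Cabs z)); [rewrite E; field|]; assumption.
Qed.

Lemma Cabs_gt0 z : z <> Czero -> 0 < Cabs z.
Proof. intros H; apply sqrt_lt_R0, Cnorm2_pos, H. Qed.

Lemma Cabs_exp z : Cabs (Cexp z) = exp (Cre z).
Proof.
  unfold Cabs, Cnorm2; simpl.
  pose proof (sin2_cos2 (Cim z)) as E; unfold Rsqr in E.
  match goal with |- sqrt ?t = _ => replace t with (Rsqr (exp (Cre z)) * (sin (Cim z) * sin (Cim z) + cos (Cim z) * cos (Cim z))) by (unfold Rsqr; ring) end.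
  rewrite E, Rmult_1_r; apply sqrt_Rsqr, Rlt_le, exp_pos.
Qed.

Lemma Cre_le_abs z : Rabs (Cre z) <= Cabs z.
Proof.
  rewrite <- sqrt_Rsqr_abs; apply sqrt_le_1_alt; unfold Rsqr, Cnorm2.
  pose proof (Rle_0_sqr (Cim z)); unfold Rsqr in *; lra.
Qed.

Lemma Cim_le_abs z : Rabs (Cim z) <= Cabs z.
Proof.
  rewrite <- sqrt_Rsqr_abs; apply sqrt_le_1_alt; unfold Rsqr, Cnorm2.
  pose proof (Rle_0_sqr (Cre z)); unfold Rsqr in *; lra.
Qed.

Lemma Cabs_le_parts z : Cabs z <= Rabs (Cre z) + Rabs (Cim z).
Proof.
  replace z with (RtoC (Cre z) + mkC 0 (Cim z))%X at 1 by (apply Cplx_eq; simpl; ring).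
  eapply Rle_trans; [apply Cabs_add|].
  rewrite Cabs_RtoC; apply Rplus_le_compat_l; right.
  rewrite <- sqrt_Rsqr_abs; unfold Cabs, Cnorm2, Rsqr; simpl; f_equal; ring.
Qed.

Lemma Cabs_pown z n : Cabs (Cpown z n) = Cabs z ^ n.
Proof.
  induction n as [|n IH]; simpl.
  - change Cone with (RtoC 1); rewrite Cabs_RtoC; apply Rabs_R1.
  - rewrite Cabs_mul, IH; ring.
Qed.

Lemma Cexp_add z w : Cexp (z + w)%X = (Cexp z * Cexp w)%X.
Proof. apply Cplx_eq; simpl; rewrite exp_plus, ?cos_plus, ?sin_plus; ring. Qed.

Lemma Cexp_0 : Cexp Czero = Cone.
Proof. apply Cplx_eq; simpl; rewrite exp_0, ?cos_0, ?sin_0; ring. Qed.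

Lemma Cexp_neq0 z : Cexp z <> Czero.
Proof.
  intros H; apply (f_equal Cabs) in H; rewrite Cabs_exp in H.
  change Czero with (RtoC 0) in H; rewrite Cabs_RtoC, Rabs_R0 in H.
  pose proof (exp_pos (Cre z)); lra.
Qed.

Lemma Cexp_opp z : Cexp (- z)%X = Cinv (Cexp z).
Proof.
  assert (E : (Cexp (- z) * Cexp z)%X = Cone).
  { rewrite <- Cexp_add, <- Cexp_0; f_equal; ring. }
  replace (Cexp (- z)%X) with (Cexp (- z) * Cexp z / Cexp z)%X by (field; apply Cexp_neq0).
  rewrite E; field; apply Cexp_neq0.
Qed.

Lemma neq0_of_Cre z : 0 < Cre z -> z <> Czero.
Proof. intros H ->; simpl in H; lra. Qed.

Lemma RtoC_add x y : RtoC (x + y) = (RtoC x + RtoC y)%X.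
Proof. apply Cplx_eq; simpl; ring. Qed.

Lemma RtoC_neq0 x : x <> 0 -> RtoC x <> Czero.
Proof. intros H E; apply H, (f_equal Cre E). Qed.

Lemma RtoC_S n : RtoC (INR (S n)) = (RtoC (INR n) + 1)%X.
Proof. rewrite S_INR; apply RtoC_add. Qed.

(** * Derivatives of complex-valued functions and mean value inequalities *)

Definition Cderiv (f : R -> Cplx) (x : R) (l : Cplx) : Prop :=
  is_derive (fun t => Cre (f t)) x (Cre l) /\ is_derive (fun t => Cim (f t)) x (Cim l).

Lemma Cderiv_eq f x l l' : Cderiv f x l -> l = l' -> Cderiv f x l'.
Proof. now intros H <-. Qed.

Lemma Cderiv_ext f g x l : (forall t, f t = g t) -> Cderiv f x l -> Cderiv g x l.
Proof.
  intros E [H1 H2]; split.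
  - eapply is_derive_ext; [intros t; now rewrite <- E|exact H1].
  - eapply is_derive_ext; [intros t; now rewrite <- E|exact H2].
Qed.

Lemma Cderiv_const k x : Cderiv (fun _ => k) x Czero.
Proof. split; apply (is_derive_const (K := R_AbsRing) (V := R_NormedModule)). Qed.

Lemma Cderiv_RtoC x : Cderiv RtoC x Cone.
Proof. split; simpl; auto_derive; trivial. Qed.

Lemma Cderiv_add f g x l m : Cderiv f x l -> Cderiv g x m -> Cderiv (fun t => f t + g t)%X x (l + m)%X.
Proof. intros [H1 H2] [H3 H4]; split; now apply (is_derive_plus (K := R_AbsRing) (V := R_NormedModule)). Qed.

Lemma Cderiv_opp f x l : Cderiv f x l -> Cderiv (fun t => - f t)%X x (- l)%X.
Proof. intros [H1 H2]; split; now apply (is_derive_opp (K := R_AbsRing) (V := R_NormedModule)). Qed.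

Lemma Cderiv_sub f g x l m : Cderiv f x l -> Cderiv g x m -> Cderiv (fun t => f t - g t)%X x (l - m)%X.
Proof. intros; apply Cderiv_add, Cderiv_opp; assumption. Qed.

Lemma is_derive_mul (f g : R -> R) x l m :
  is_derive f x l -> is_derive g x m -> is_derive (fun t => f t * g t) x (l * g x + f x * m).
Proof. intros; apply (is_derive_mult f g); auto; intros; apply Rmult_comm. Qed.

Lemma Cderiv_mul f g x l m :
  Cderiv f x l -> Cderiv g x m -> Cderiv (fun t => f t * g t)%X x (l * g x + f x * m)%X.
Proof.
  intros [H1 H2] [H3 H4]; split; simpl.
  - pose proof (is_derive_minus _ _ _ _ _ (is_derive_mul _ _ _ _ _ H1 H3) (is_derive_mul _ _ _ _ _ H2 H4)) as H.
    evar_last; [exact H|]. unfold minus, plus, opp; simpl; ring.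
  - pose proof (is_derive_plus _ _ _ _ _ (is_derive_mul _ _ _ _ _ H1 H4) (is_derive_mul _ _ _ _ _ H2 H3)) as H.
    evar_last; [exact H|]. unfold plus; simpl; ring.
Qed.

Lemma Cderiv_scal k f x l : Cderiv f x l -> Cderiv (fun t => k * f t)%X x (k * l)%X.
Proof.
  intros H; eapply Cderiv_eq; [apply Cderiv_mul; [apply Cderiv_const|exact H]|simpl; ring].
Qed.

Lemma is_derive_comp_R (f g : R -> R) x l m :
  is_derive f (g x) l -> is_derive g x m -> is_derive (fun t => f (g t)) x (l * m).
Proof.
  intros H1 H2; evar_last; [apply (is_derive_comp f g); eassumption|].
  unfold scal; simpl; unfold mult; simpl; ring.
Qed.

Lemma Cderiv_exp f x l : Cderiv f x l -> Cderiv (fun t => Cexp (f t)) x (Cexp (f x) * l)%X.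
Proof.
  intros [H1 H2].
  pose proof (is_derive_comp_R _ _ _ _ _ (proj2 (is_derive_Reals _ _ _) (derivable_pt_lim_exp (Cre (f x)))) H1) as He.
  pose proof (is_derive_comp_R _ _ _ _ _ (proj2 (is_derive_Reals _ _ _) (derivable_pt_lim_cos (Cim (f x)))) H2) as Hc.
  pose proof (is_derive_comp_R _ _ _ _ _ (proj2 (is_derive_Reals _ _ _) (derivable_pt_lim_sin (Cim (f x)))) H2) as Hs.
  split; simpl.
  - evar_last; [apply (is_derive_mul _ _ _ _ _ He Hc)|ring].
  - evar_last; [apply (is_derive_mul _ _ _ _ _ He Hs)|ring].
Qed.

Lemma Cderiv_continuous f x l : Cderiv f x l ->
  continuous (fun t => Cre (f t)) x /\ continuous (fun t => Cim (f t)) x.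
Proof.
  intros [H1 H2]; split; apply (ex_derive_continuous (K := R_AbsRing) (V := R_NormedModule)); eexists; eassumption.
Qed.

(** Every logarithm in the proof is taken of 2 or of some [1 - z] with [|z| < 1], so the other
    branches of [Carg] never occur. *)
Lemma Clog_right_half z : 0 < Cre z -> Clog z = mkC (ln (Cabs z)) (atan (Cim z / Cre z)).
Proof.
  intros H; unfold Clog, Carg; cbv zeta; f_equal.
  destruct (Rlt_dec 0 (Cre z)); [reflexivity|contradiction].
Qed.

Lemma is_derive_ln_norm (u w : R -> R) x l m :
  is_derive u x l -> is_derive w x m -> 0 < u x * u x + w x * w x ->
  is_derive (fun t => ln (sqrt (u t * u t + w t * w t))) x
    ((l * u x + m * w x) / (u x * u x + w x * w x)).
Proof.
  intros H1 H2 Hn; auto_derive.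
  - repeat split; try (eexists; eassumption); try assumption. apply sqrt_lt_R0; assumption.
  - change (fun t : R => u t) with u; change (fun t : R => w t) with w.
    rewrite (is_derive_unique _ _ _ H1), (is_derive_unique _ _ _ H2).
    set (s := u x * u x + w x * w x) in *.
    assert (E : sqrt s * sqrt s = s) by (apply sqrt_sqrt; lra).
    assert (0 < sqrt s) by (apply sqrt_lt_R0; assumption).
    transitivity ((l * u x + m * w x) / (sqrt s * sqrt s)); [field; lra|now rewrite E].
Qed.

Lemma is_derive_atan_div (u w : R -> R) x l m :
  is_derive u x l -> is_derive w x m -> u x <> 0 ->
  is_derive (fun t => atan (w t / u t)) x ((m * u x - l * w x) / (u x * u x + w x * w x)).
Proof.
  intros H1 H2 Hn; auto_derive.
  - repeat split; try (eexists; eassumption); assumption.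
  - change (fun t : R => u t) with u; change (fun t : R => w t) with w.
    rewrite (is_derive_unique _ _ _ H1), (is_derive_unique _ _ _ H2).
    field; split; [|assumption]. nra.
Qed.

(** Positivity of the real part is an open condition, so near [x] the logarithm coincides with the
    arctangent formula, which is differentiated part by part. *)
Lemma Cderiv_log f x l : Cderiv f x l -> 0 < Cre (f x) -> Cderiv (fun t => Clog (f t)) x (l / f x)%X.
Proof.
  intros D Hp; pose proof D as [H1 H2].
  assert (Hloc : locally x (fun t => mkC (ln (Cabs (f t))) (atan (Cim (f t) / Cre (f t))) = Clog (f t))).
  { destruct (Cderiv_continuous _ _ _ D) as [Hc _].
    eapply filter_imp; [|apply (Hc (fun r => 0 < r)), (open_gt 0 _ Hp)].
    intros t Ht; symmetry; apply Clog_right_half, Ht. }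
  assert (Hn : 0 < Cnorm2 (f x)) by (unfold Cnorm2; nra).
  split.
  - eapply is_derive_ext_loc; [eapply filter_imp; [|exact Hloc]; intros t Ht; rewrite <- Ht; reflexivity|].
    evar_last; [apply (is_derive_ln_norm _ _ _ _ _ H1 H2 Hn)|].
    unfold Cnorm2 in *; simpl; unfold Cnorm2; field; lra.
  - eapply is_derive_ext_loc; [eapply filter_imp; [|exact Hloc]; intros t Ht; rewrite <- Ht; reflexivity|].
    evar_last; [apply (is_derive_atan_div _ _ _ _ _ H1 H2); lra|].
    unfold Cnorm2 in *; simpl; unfold Cnorm2; field; lra.
Qed.

(** The mean value theorem for [h - g]. It stands in for integral estimates: bounds are compared
    through explicit primitives. *)
Lemma deriv_compare (g g' h h' : R -> R) (p q : R) :
  p <= q ->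
  (forall t, p <= t <= q -> is_derive g t (g' t)) ->
  (forall t, p <= t <= q -> is_derive h t (h' t)) ->
  (forall t, p <= t <= q -> g' t <= h' t) ->
  g q - g p <= h q - h p.
Proof.
  intros Hpq Hg Hh Hle.
  destruct (MVT_gen (fun t => h t - g t) p q (fun t => h' t - g' t)) as [xi [Hxi E]].
  - intros t Ht; rewrite Rmin_left, Rmax_right in Ht by lra.
    apply (is_derive_minus (K := R_AbsRing) (V := R_NormedModule)); [apply Hh|apply Hg]; lra.
  - intros t Ht; rewrite Rmin_left, Rmax_right in Ht by lra.
    apply continuity_pt_filterlim, (ex_derive_continuous (fun t => h t - g t) t).
    eexists; apply (is_derive_minus h g); [apply Hh|apply Hg]; lra.
  - rewrite Rmin_left, Rmax_right in Hxi by lra.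
    specialize (Hle xi Hxi). nra.
Qed.

(** The mean value theorem fails for complex values, so real and imaginary parts are compared
    separately, each from both sides; adding them gives the factor 2. *)
Lemma Cderiv_compare (f f' : R -> Cplx) (h h' : R -> R) (p q : R) :
  p <= q ->
  (forall t, p <= t <= q -> Cderiv f t (f' t)) ->
  (forall t, p <= t <= q -> is_derive h t (h' t)) ->
  (forall t, p <= t <= q -> Cabs (f' t) <= h' t) ->
  Cabs (f q - f p)%X <= 2 * (h q - h p).
Proof.
  intros Hpq Hf Hh Hle.
  assert (HR : forall t, p <= t <= q -> - h' t <= Cre (f' t) <= h' t /\ - h' t <= Cim (f' t) <= h' t).
  { intros t Ht; specialize (Hle t Ht).
    pose proof (Cre_le_abs (f' t)); pose proof (Cim_le_abs (f' t)).
    split; apply Rabs_le_between; lra. }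
  assert (Ho : forall t, p <= t <= q -> is_derive (fun t => - h t) t (- h' t)).
  { intros t Ht; apply (is_derive_opp (K := R_AbsRing) (V := R_NormedModule)), Hh, Ht. }
  eapply Rle_trans; [apply Cabs_le_parts|]; simpl.
  assert (A1 := deriv_compare (fun t => Cre (f t)) (fun t => Cre (f' t)) h h' p q Hpq
    (fun t Ht => proj1 (Hf t Ht)) Hh (fun t Ht => proj2 (proj1 (HR t Ht)))).
  assert (A2 := deriv_compare (fun t => Cim (f t)) (fun t => Cim (f' t)) h h' p q Hpq
    (fun t Ht => proj2 (Hf t Ht)) Hh (fun t Ht => proj2 (proj2 (HR t Ht)))).
  assert (A3 := deriv_compare _ _ (fun t => Cre (f t)) (fun t => Cre (f' t)) p q Hpq Ho
    (fun t Ht => proj1 (Hf t Ht)) (fun t Ht => proj1 (proj1 (HR t Ht)))).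
  assert (A4 := deriv_compare _ _ (fun t => Cim (f t)) (fun t => Cim (f' t)) p q Hpq Ho
    (fun t Ht => proj2 (Hf t Ht)) (fun t Ht => proj1 (proj2 (HR t Ht)))).
  cbv beta in *.
  assert (Rabs (Cre (f q) + - Cre (f p)) <= h q - h p) by (apply Rabs_le_between; lra).
  assert (Rabs (Cim (f q) + - Cim (f p)) <= h q - h p) by (apply Rabs_le_between; lra).
  lra.
Qed.

(** * Termwise improper integration *)

(** The partial sums from [N0] on telescope and stay below [w N0]. The comparison is only asked
    eventually because the ratio estimate that it serves is asymptotic. *)
Lemma ex_series_telescope (a w : nat -> R) (N0 : nat) :
  (forall n, (N0 <= n)%nat -> 0 <= a n <= w n - w (S n)) ->
  (forall n, (N0 <= n)%nat -> 0 <= w n) ->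
  ex_series a.
Proof.
  intros Ha Hw; apply (ex_series_incr_n a N0).
  assert (B : forall n, sum_n (fun k => a (N0 + k)%nat) n <= w N0 - w (S (N0 + n))).
  { induction n as [|n IH].
    - rewrite sum_O, Nat.add_0_r; apply Ha; lia.
    - rewrite sum_Sn; unfold plus; simpl.
      pose proof (Ha (N0 + S n)%nat ltac:(lia)) as H.
      rewrite Nat.add_succ_r in *; lra. }
  destruct (ex_finite_lim_seq_incr (sum_n (fun k => a (N0 + k)%nat)) (w N0)) as [l Hl].
  - intros n; rewrite sum_Sn; unfold plus; simpl.
    pose proof (Ha (N0 + S n)%nat ltac:(lia)); lra.
  - intros n; pose proof (B n); pose proof (Hw (S (N0 + n)) ltac:(lia)); lra.
  - exists l; exact Hl.
Qed.

Lemma is_lim_seq_series (a : nat -> R) : ex_series a -> is_lim_seq (sum_n a) (Series a).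
Proof. intros H; exact (Series_correct a H). Qed.

Lemma ex_series_dominated (h M : nat -> R) :
  ex_series M -> (forall n, Rabs (h n) <= M n) -> ex_series h.
Proof. intros HM Hh; apply (ex_series_le (K := R_AbsRing) (V := R_CompleteNormedModule) h M Hh HM). Qed.

Lemma Series_tail_le (h M : nat -> R) (N : nat) :
  ex_series M -> (forall n, Rabs (h n) <= M n) ->
  Rabs (Series h - sum_n h N) <= Series M - sum_n M N.
Proof.
  intros HM Hh.
  assert (Hs := ex_series_dominated h M HM Hh).
  rewrite (Series_incr_n h (S N) ltac:(lia) Hs), (Series_incr_n M (S N) ltac:(lia) HM).
  rewrite !sum_n_Reals; simpl pred.
  match goal with |- Rabs (?s + ?x - ?s) <= ?t + ?y - ?t =>
    replace (s + x - s) with x by ring; replace (t + y - t) with y by ring end.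
  assert (HM' : ex_series (fun k => M (S N + k)%nat)) by (apply ex_series_incr_n, HM).
  eapply Rle_trans; [apply Series_Rabs|apply Series_le; [|exact HM']].
  - apply (ex_series_dominated _ _ HM'); intros n; rewrite Rabs_Rabsolu; apply Hh.
  - intros n; split; [apply Rabs_pos|apply Hh].
Qed.

Lemma filterlim_sum_n (F : (R -> Prop) -> Prop) {FF : Filter F} (h : nat -> R -> R) (l : nat -> R) :
  (forall n, filterlim (h n) F (locally (l n))) ->
  forall N, filterlim (fun x => sum_n (fun n => h n x) N) F (locally (sum_n l N)).
Proof.
  intros H; induction N as [|N IH].
  - apply (filterlim_ext (h 0%nat)); [intros x; symmetry; apply (sum_O (fun n => h n x))|rewrite sum_O; apply H].
  - apply (filterlim_ext (fun x => plus (sum_n (fun n => h n x) N) (h (S N) x)));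
      [intros x; symmetry; apply (sum_Sn (fun n => h n x))|rewrite sum_Sn].
    eapply filterlim_comp_2; [exact IH|apply H|apply (filterlim_plus (K := R_AbsRing) (V := R_NormedModule))].
Qed.

(** Dominated convergence for series, along an arbitrary filter so that it serves both at [0+] and
    at infinity. Cutting at [N] leaves three errors, the tail of [h], the head and the tail of [l],
    each below [eps / 4]. *)
Lemma tannery (F : (R -> Prop) -> Prop) {FF : Filter F} (h : nat -> R -> R) (l M : nat -> R) (L : R) :
  ex_series M ->
  F (fun x => forall n, Rabs (h n x) <= M n) ->
  (forall n, filterlim (h n) F (locally (l n))) ->
  is_series l L ->
  filterlim (fun x => Series (fun n => h n x)) F (locally L).
Proof.
  intros HM Hdom Hl HL.
  apply filterlim_locally; intros eps.
  pose proof (is_lim_seq_series M HM) as HT.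
  apply is_lim_seq_spec in HT.
  assert (HL' : is_lim_seq (sum_n l) L) by exact HL.
  apply is_lim_seq_spec in HL'.
  assert (He : 0 < eps / 4) by (pose proof (cond_pos eps); lra).
  destruct (HT (mkposreal _ He)) as [N1 H1]; destruct (HL' (mkposreal _ He)) as [N2 H2].
  set (N := max N1 N2).
  specialize (H1 N ltac:(lia)); specialize (H2 N ltac:(lia)); simpl in H1, H2.
  pose proof (filterlim_sum_n F h l Hl N) as H3.
  pose proof (proj1 (filterlim_locally _ _) H3 (mkposreal _ He)) as H3'.
  generalize (filter_and _ _ Hdom H3'); apply filter_imp.
  intros x [Hx1 Hx2].
  pose proof (Series_tail_le (fun n => h n x) M N HM Hx1) as H4.
  change (Rabs (sum_n (fun n => h n x) N - sum_n l N) < eps / 4) in Hx2.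
  change (Rabs (Series (fun n => h n x) - L) < eps).
  apply Rabs_lt_between in Hx2; apply Rabs_lt_between in H1; apply Rabs_lt_between in H2.
  apply Rabs_le_between in H4. apply Rabs_lt_between; lra.
Qed.

Lemma is_derive_sum_n (T g : nat -> R -> R) (x : R) :
  (forall n, is_derive (T n) x (- g n x)) ->
  forall N, is_derive (fun y => sum_n (fun n => T n y) N) x (- sum_n (fun n => g n x) N).
Proof.
  intros H; induction N as [|N IH].
  - apply (is_derive_ext (T 0%nat)); [intros y; symmetry; apply (sum_O (fun n => T n y))|rewrite sum_O; apply H].
  - apply (is_derive_ext (fun y => plus (sum_n (fun n => T n y) N) (T (S N) y)));
      [intros y; symmetry; apply (sum_Sn (fun n => T n y))|rewrite sum_Sn].
    evar_last; [apply (is_derive_plus (K := R_AbsRing) (V := R_NormedModule)); [exact IH|apply H]|].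
    unfold plus; simpl; ring.
Qed.

(** [RInt f e y] plus the [N]-th partial sum of the [T n y] has as derivative the uniformly small
    remainder of the expansion, so it is almost constant on [[e, t]]. Hence the partial sums at [e]
    minus those at [t] tend to the integral as well as to the difference of the two series. *)
Lemma RInt_termwise (f : R -> R) (T g : nat -> R -> R) (M : nat -> R) (e t : R) :
  0 < e -> e <= t ->
  (forall x, 0 < x -> continuous f x) ->
  (forall n x, 0 < x -> is_derive (T n) x (- g n x)) ->
  (forall eps, 0 < eps -> exists N0, forall N, (N0 <= N)%nat ->
     forall x, e <= x <= t -> Rabs (f x - sum_n (fun n => g n x) N) <= eps) ->
  ex_series M -> (forall n x, 0 < x -> Rabs (T n x) <= M n) ->
  RInt f e t = Series (fun n => T n e) - Series (fun n => T n t).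
Proof.
  intros He Het Hf HT Hu HM Hdom.
  assert (Hex : forall y, 0 < y -> ex_RInt f e y).
  { intros y Hy; apply (ex_RInt_continuous (V := R_CompleteNormedModule)); intros z Hz; apply Hf.
    eapply Rlt_le_trans; [|apply Hz]; apply Rmin_pos; assumption. }
  assert (HPhi : forall x, 0 < x -> is_derive (fun y => RInt f e y) x (f x)).
  { intros x Hx; apply (is_derive_RInt f (fun y => RInt f e y) e x); [|apply Hf, Hx].
    eapply filter_imp; [|apply (open_gt 0 x Hx)].
    intros y Hy; apply (RInt_correct (V := R_CompleteNormedModule)), Hex, Hy. }
  set (SN := fun N y => sum_n (fun n => T n y) N).
  assert (L1 : is_lim_seq (fun N => SN N e - SN N t) (Series (fun n => T n e) - Series (fun n => T n t))).
  { apply (is_lim_seq_minus' (fun N => SN N e) (fun N => SN N t));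
      apply is_lim_seq_series, (ex_series_dominated _ M HM); intros n; apply Hdom; lra. }
  assert (L2 : is_lim_seq (fun N => SN N e - SN N t) (RInt f e t)).
  { apply is_lim_seq_spec; intros eps.
    (* The added 1 keeps the divisor positive when [e = t] and makes the final inequality strict. *)
    assert (Hd : 0 < eps / (t - e + 1)) by (apply Rdiv_lt_0_compat; [apply cond_pos|lra]).
    destruct (Hu _ Hd) as [N0 HN0]; exists N0; intros N HN.
    specialize (HN0 N HN); set (d := eps / (t - e + 1)) in *.
    assert (Hsum : forall x, e <= x <= t ->
      is_derive (fun y => RInt f e y + SN N y) x (f x - sum_n (fun n => g n x) N)).
    { intros x Hx; apply (is_derive_plus (fun y => RInt f e y) (SN N)).
      - apply HPhi; lra.
      - apply is_derive_sum_n; intros n; apply HT; lra. }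
    assert (Hlin : forall k x, e <= x <= t -> is_derive (fun y => k * y) x k).
    { intros k x _; auto_derive; [trivial|ring]. }
    pose proof (deriv_compare _ _ _ _ e t Het Hsum (Hlin d)) as A1.
    pose proof (deriv_compare _ _ _ _ e t Het (Hlin (- d)) Hsum) as A2.
    cbv beta in A1, A2; rewrite RInt_point in A1, A2; unfold zero in A1, A2; simpl in A1, A2.
    assert (Hdt : d * (t - e) < eps).
    { assert (d * (t - e + 1) = eps) by (unfold d; field; lra). lra. }
    assert (B1 : forall x, e <= x <= t -> f x - sum_n (fun n => g n x) N <= d).
    { intros x Hx; specialize (HN0 x Hx); apply Rabs_le_between in HN0; lra. }
    assert (B2 : forall x, e <= x <= t -> - d <= f x - sum_n (fun n => g n x) N).
    { intros x Hx; specialize (HN0 x Hx); apply Rabs_le_between in HN0; lra. }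
    specialize (A1 B1); specialize (A2 B2).
    apply Rabs_lt_between; lra. }
  apply is_lim_seq_unique in L1; apply is_lim_seq_unique in L2.
  rewrite L1 in L2; injection L2; auto.
Qed.

(** With [Phi x] the sum of the [T n x], the integral over [[e, t]] is [Phi e - Phi t]; [tannery]
    gives [Phi] the limit [L] at [0+] and 0 at infinity. *)
Lemma real_termwise_improper_integral (f : R -> R) (T g : nat -> R -> R) (T0 M : nat -> R) (L : R) :
  (forall x, 0 < x -> continuous f x) ->
  (forall n x, 0 < x -> is_derive (T n) x (- g n x)) ->
  (forall e t eps, 0 < e -> e <= t -> 0 < eps -> exists N0, forall N, (N0 <= N)%nat ->
     forall x, e <= x <= t -> Rabs (f x - sum_n (fun n => g n x) N) <= eps) ->
  ex_series M -> (forall n x, 0 < x -> Rabs (T n x) <= M n) ->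
  (forall n, filterlim (T n) (at_right 0) (locally (T0 n))) ->
  (forall n, filterlim (T n) (Rbar_locally p_infty) (locally 0)) ->
  is_series T0 L ->
  (forall e t, 0 < e -> e <= t -> inhabited (Riemann_integrable f e t)) /\
  (forall eps, 0 < eps -> exists delta, 0 < delta /\ exists B, forall e t
     (pr : Riemann_integrable f e t), 0 < e -> e < delta -> B < t ->
     Rabs (RiemannInt pr - L) < eps).
Proof.
  intros Hf HT Hu HM Hdom H0 Hinf HL; split.
  - intros e t He Het; constructor; apply continuity_implies_RiemannInt; [exact Het|].
    intros x Hx; apply continuity_pt_filterlim, Hf; lra.
  - intros eps Heps.
    assert (Hz : is_series (fun _ : nat => 0) 0).
    { change (is_lim_seq (sum_n (fun _ : nat => 0)) 0); apply is_lim_seq_ext with (fun _ => 0); [|apply is_lim_seq_const].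
      intros n; rewrite sum_n_const; ring. }
    assert (F0 : filterlim (fun x => Series (fun n => T n x)) (at_right 0) (locally L)).
    { apply (tannery (at_right 0) T T0 M L HM); auto.
      exists (mkposreal 1 Rlt_0_1); intros y _ Hy n; apply Hdom, Hy. }
    assert (Fi : filterlim (fun x => Series (fun n => T n x)) (Rbar_locally p_infty) (locally 0)).
    { apply (tannery (Rbar_locally p_infty) T (fun _ => 0) M 0 HM); auto.
      exists 0; intros y Hy n; apply Hdom, Hy. }
    assert (He2 : 0 < eps / 2) by lra.
    destruct (proj1 (filterlim_locally _ _) F0 (mkposreal _ He2)) as [d Hd].
    destruct (proj1 (filterlim_locally _ _) Fi (mkposreal _ He2)) as [B HB].
    (* The maximum with [d] forces [e < d < t], so that the interval is correctly oriented. *)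
    exists d; split; [apply cond_pos|]; exists (Rmax d B); intros e t pr He Hed HBt.
    pose proof (Rmax_l d B); pose proof (Rmax_r d B).
    rewrite <- RInt_Reals.
    rewrite (RInt_termwise f T g M e t He ltac:(lra) Hf HT); auto; [|intros; apply Hu; lra].
    assert (X1 := Hd e).
    assert (X2 := HB t ltac:(lra)).
    change (Rabs (Series (fun n => T n t) - 0) < eps / 2) in X2.
    assert (X3 : Rabs (Series (fun n => T n e) - L) < eps / 2).
    { apply X1; [|exact He]. change (Rabs (e - 0) < d). rewrite Rabs_pos_eq; lra. }
    apply Rabs_lt_between in X2; apply Rabs_lt_between in X3; apply Rabs_lt_between; lra.
Qed.

(** * Complex series and termwise integration of complex integrands *)

Lemma Cre_partial_sum f N : Cre (Cpartial_sum f N) = sum_n (fun n => Cre (f n)) N.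
Proof.
  induction N as [|N IH]; simpl; [now rewrite sum_O|now rewrite sum_Sn, IH].
Qed.

Lemma Cim_partial_sum f N : Cim (Cpartial_sum f N) = sum_n (fun n => Cim (f n)) N.
Proof.
  induction N as [|N IH]; simpl; [now rewrite sum_O|now rewrite sum_Sn, IH].
Qed.

Lemma Cseries_cv_is_series f S :
  Cseries_cv f S <-> is_series (fun n => Cre (f n)) (Cre S) /\ is_series (fun n => Cim (f n)) (Cim S).
Proof.
  unfold Cseries_cv.
  assert (E : forall u v l, (forall n : nat, u n = v n) -> Un_cv u l <-> filterlim v eventually (locally l)).
  { intros u v l H; rewrite <- is_lim_seq_Reals; change (is_lim_seq u l <-> is_lim_seq v l); split; apply is_lim_seq_ext; auto. }
  rewrite (E _ _ _ (Cre_partial_sum f)), (E _ _ _ (Cim_partial_sum f)); reflexivity.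
Qed.

Lemma Cseries_cv_dominated f (M : nat -> R) :
  ex_series M -> (forall n, Cabs (f n) <= M n) -> exists S, Cseries_cv f S.
Proof.
  intros HM Hf.
  exists (mkC (Series (fun n => Cre (f n))) (Series (fun n => Cim (f n)))).
  apply Cseries_cv_is_series; split; apply Series_correct, (ex_series_dominated _ M HM);
    intros n; (eapply Rle_trans; [|apply Hf]); [apply Cre_le_abs|apply Cim_le_abs].
Qed.

Lemma Cseries_cv_scal k f S : Cseries_cv f S -> Cseries_cv (fun n => k * f n)%X (k * S)%X.
Proof.
  rewrite !Cseries_cv_is_series; intros [H1 H2]; split; simpl.
  - apply (is_series_minus (V := R_NormedModule));
      now apply (is_series_scal (V := R_NormedModule)).
  - apply (is_series_plus (V := R_NormedModule));
      now apply (is_series_scal (V := R_NormedModule)).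
Qed.

Lemma Cseries_cv_ext f g S : (forall n, f n = g n) -> Cseries_cv f S -> Cseries_cv g S.
Proof.
  rewrite !Cseries_cv_is_series; intros E [H1 H2]; split.
  - eapply is_series_ext; [intros n; rewrite <- E; reflexivity|exact H1].
  - eapply is_series_ext; [intros n; rewrite <- E; reflexivity|exact H2].
Qed.

(** The integrand may be singular at 0, so its differentiability is asked only for [x > 0]; each
    [T n] is differentiable on the whole line, and its continuity at 0 turns [T n 0] into the
    right-hand limit. *)
Lemma termwise_improper_integral (f : R -> Cplx) (T g : nat -> R -> Cplx)
    (M : nat -> R) (L : Cplx) :
  (forall x, 0 < x -> exists l, Cderiv f x l) ->
  (forall n x, Cderiv (T n) x (- g n x)%X) ->
  (forall e t eps, 0 < e -> e <= t -> 0 < eps -> exists N0, forall N, (N0 <= N)%nat ->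
     forall x, e <= x <= t -> Cabs (f x - Cpartial_sum (fun n => g n x) N)%X <= eps) ->
  ex_series M -> (forall n x, 0 < x -> Cabs (T n x) <= M n) ->
  (forall n, is_lim (fun x => Cabs (T n x)) p_infty 0) ->
  Cseries_cv (fun n => T n 0) L ->
  improper_integral_0_inf f L.
Proof.
  intros Hf HT Hu HM Hdom Hinf HL.
  apply Cseries_cv_is_series in HL; destruct HL as [HLr HLi].
  assert (Hlim : forall p : Cplx -> R, (forall z, Rabs (p z) <= Cabs z) -> forall n,
    filterlim (fun x => p (T n x)) (Rbar_locally p_infty) (locally 0)).
  { intros p Hp n. apply filterlim_locally; intros eps.
    generalize (proj1 (filterlim_locally _ _) (Hinf n) eps); apply filter_imp; intros x Hx.
    change (Rabs (Cabs (T n x) - 0) < eps) in Hx; change (Rabs (p (T n x) - 0) < eps).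
    rewrite Rminus_0_r in *; rewrite Rabs_pos_eq in Hx by apply Cabs_ge0.
    eapply Rle_lt_trans; [apply Hp|exact Hx]. }
  assert (Hz : forall h : R -> R, continuous h 0 -> filterlim h (at_right 0) (locally (h 0))).
  { intros h Hh. eapply filterlim_filter_le_1; [|exact Hh]. apply filter_le_within. }
  destruct (real_termwise_improper_integral (fun x => Cre (f x)) (fun n x => Cre (T n x))
    (fun n x => Cre (g n x)) (fun n => Cre (T n 0)) M (Cre L)) as [I1 J1]; auto.
  - intros x Hx; destruct (Hf x Hx) as [l Hl]; apply (Cderiv_continuous _ _ _ Hl).
  - intros n x _; apply (proj1 (HT n x)).
  - intros e t eps He Het Heps; destruct (Hu e t eps He Het Heps) as [N0 H]; exists N0.
    intros N HN x Hx; specialize (H N HN x Hx); rewrite <- Cre_partial_sum.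
    eapply Rle_trans; [|exact H]. apply (Cre_le_abs (f x - Cpartial_sum (fun n => g n x) N)%X).
  - intros n x Hx; eapply Rle_trans; [apply Cre_le_abs|apply Hdom, Hx].
  - intros n; apply (Hz (fun x => Cre (T n x))), (Cderiv_continuous _ _ _ (HT n 0)).
  - apply Hlim, Cre_le_abs.
  - destruct (real_termwise_improper_integral (fun x => Cim (f x)) (fun n x => Cim (T n x))
      (fun n x => Cim (g n x)) (fun n => Cim (T n 0)) M (Cim L)) as [I2 J2]; auto.
    + intros x Hx; destruct (Hf x Hx) as [l Hl]; apply (Cderiv_continuous _ _ _ Hl).
    + intros n x _; apply (proj2 (HT n x)).
    + intros e t eps He Het Heps; destruct (Hu e t eps He Het Heps) as [N0 H]; exists N0.
      intros N HN x Hx; specialize (H N HN x Hx); rewrite <- Cim_partial_sum.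
      eapply Rle_trans; [|exact H]. apply (Cim_le_abs (f x - Cpartial_sum (fun n => g n x) N)%X).
    + intros n x Hx; eapply Rle_trans; [apply Cim_le_abs|apply Hdom, Hx].
    + intros n; apply (Hz (fun x => Cim (T n x))), (Cderiv_continuous _ _ _ (HT n 0)).
    + apply Hlim, Cim_le_abs.
    + split; [intros e t He Het; split; [apply I1|apply I2]; assumption|].
      intros eps Heps; destruct (J1 eps Heps) as (d1 & Hd1 & B1 & H1); destruct (J2 eps Heps) as (d2 & Hd2 & B2 & H2).
      exists (Rmin d1 d2); split; [now apply Rmin_pos|]; exists (Rmax B1 B2); intros e t pr1 pr2 He Hed HBt.
      pose proof (Rmin_l d1 d2); pose proof (Rmin_r d1 d2); pose proof (Rmax_l B1 B2); pose proof (Rmax_r B1 B2).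
      split; [apply H1|apply H2]; lra.
Qed.

(** * The binomial series *)

(** The coefficient of [z^n] in the expansion of [(1 - z)^(-v)]. *)
Definition binom_coef (v : Cplx) (n : nat) : Cplx := (Cpoch v n / RtoC (INR (fact n)))%X.

Definition binom_sum (v : Cplx) (N : nat) (z : Cplx) : Cplx :=
  Cpartial_sum (fun n => binom_coef v n * Cpown z n)%X N.

Lemma INR_S_neq0 n : (RtoC (INR n) + 1)%X <> Czero.
Proof. rewrite <- RtoC_S; apply RtoC_neq0, not_0_INR; lia. Qed.

Lemma fact_Cplx_neq0 n : RtoC (INR (fact n)) <> Czero.
Proof. apply RtoC_neq0, not_0_INR, fact_neq_0. Qed.

Lemma fact_Cplx_S n : RtoC (INR (fact (S n))) = (RtoC (INR (fact n)) * (RtoC (INR n) + 1))%X.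
Proof.
  rewrite <- RtoC_S, fact_simpl, mult_INR; apply Cplx_eq; simpl; ring.
Qed.

Lemma binom_coef_S v n :
  ((RtoC (INR n) + 1) * binom_coef v (S n))%X = ((v + RtoC (INR n)) * binom_coef v n)%X.
Proof.
  unfold binom_coef; rewrite fact_Cplx_S; simpl Cpoch.
  field; split; [apply fact_Cplx_neq0|apply INR_S_neq0].
Qed.

Lemma Cabs_binom_coef_S v n :
  (INR n + 1) * Cabs (binom_coef v (S n)) = Cabs (v + RtoC (INR n))%X * Cabs (binom_coef v n).
Proof.
  rewrite <- Cabs_mul, <- binom_coef_S, Cabs_mul; f_equal.
  rewrite <- RtoC_S, Cabs_RtoC, S_INR, Rabs_pos_eq; [reflexivity|].
  pose proof (pos_INR n); lra.
Qed.

(** As [|v + n|^2 = (n + s)^2 + y^2], the imaginary part adds only [O(1/n)] to the modulus. The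
    triangle inequality would bring in [|v|], whereas a condition on [Re v] calls for the real part
    alone. *)
Lemma Cabs_add_INR_eventually v d : 0 < d ->
  exists N0, forall n, (N0 <= n)%nat -> Cabs (v + RtoC (INR n))%X <= INR n + Cre v + d.
Proof.
  intros Hd; set (s := Cre v); set (y := Cim v).
  destruct (INR_unbounded (y * y / d + Rabs s + Rabs (s + d))) as [N0 HN0].
  exists N0; intros n Hn; apply le_INR in Hn.
  assert (E : y * y / d * d = y * y) by (field; lra).
  assert (Q : 0 <= y * y / d) by (apply Rdiv_le_0_compat; nra).
  set (q := y * y / d) in *.
  pose proof (Rabs_pos s); pose proof (Rabs_pos (s + d)).
  pose proof (Rcomplements.Rabs_maj2 s); pose proof (Rcomplements.Rabs_maj2 (s + d)).
  rewrite <- (sqrt_Rsqr (INR n + s + d)) by lra.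
  apply sqrt_le_1_alt; unfold Rsqr, Cnorm2; simpl.
  fold s y. nra.
Qed.

(* With u_n the general term, (n+4) u_{n+1} = |v+n| u_n <= (n+3-d) u_n eventually, so
   d u_n <= (n+3) u_n - (n+4) u_{n+1} telescopes. *)
Lemma ex_series_binom_coef v : Cre v < 3 ->
  ex_series (fun n => Cabs (binom_coef v n) / ((INR n + 1) * (INR n + 2) * (INR n + 3))).
Proof.
  intros Hv; set (u := fun n => _).
  assert (Hd : 0 < (3 - Cre v) / 2) by lra.
  destruct (Cabs_add_INR_eventually v _ Hd) as [N0 HN0].
  set (d := (3 - Cre v) / 2) in *.
  assert (Hu : forall n, 0 <= u n).
  { intros n; pose proof (pos_INR n); apply Rdiv_le_0_compat; [apply Cabs_ge0|].
    repeat apply Rmult_lt_0_compat; lra. }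
  assert (HS : forall n, (INR n + 4) * u (S n) = Cabs (v + RtoC (INR n))%X * u n).
  { intros n; unfold u; pose proof (pos_INR n) as Hn; pose proof (Cabs_binom_coef_S v n) as E.
    rewrite S_INR.
    replace (Cabs (v + RtoC (INR n))%X * (Cabs (binom_coef v n) / ((INR n + 1) * (INR n + 2) * (INR n + 3))))
      with (Cabs (v + RtoC (INR n))%X * Cabs (binom_coef v n) / ((INR n + 1) * (INR n + 2) * (INR n + 3)))
      by (field; lra).
    rewrite <- E; field; lra. }
  apply (ex_series_telescope u (fun n => (INR n + 3) * u n / d) N0).
  - intros n Hn; split; [apply Hu|].
    rewrite S_INR; replace (INR n + 1 + 3) with (INR n + 4) by ring; rewrite HS.
    specialize (HN0 n Hn); specialize (Hu n).
    replace ((INR n + 3) * u n / d - Cabs (v + RtoC (INR n))%X * u n / d)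
      with (u n + (INR n + Cre v + d - Cabs (v + RtoC (INR n))%X) * (u n / d)).
    + assert (0 <= u n / d) by (apply Rdiv_le_0_compat; lra). nra.
    + assert (Cre v = 3 - 2 * d) by (unfold d; field). rewrite H; field; lra.
  - intros n _; pose proof (pos_INR n); specialize (Hu n).
    apply Rdiv_le_0_compat; [nra|lra].
Qed.

Lemma is_lim_seq_ratio (a : nat -> R) (q : R) (N0 : nat) :
  0 <= q < 1 -> (forall n, 0 <= a n) ->
  (forall n, (N0 <= n)%nat -> a (S n) <= q * a n) -> is_lim_seq a 0.
Proof.
  intros Hq Ha Hs; apply (is_lim_seq_incr_n a N0).
  apply (is_lim_seq_le_le (fun _ => 0) _ (fun n => a N0 * q ^ n)).
  - intros n; split; [apply Ha|].
    induction n as [|n IH]; simpl; [lra|].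
    eapply Rle_trans; [apply Hs; lia|].
    replace (a N0 * (q * q ^ n)) with (q * (a N0 * q ^ n)) by ring.
    apply Rmult_le_compat_l; tauto.
  - apply is_lim_seq_const.
  - evar_last; [apply is_lim_seq_scal_l, is_lim_seq_geom; rewrite Rabs_pos_eq; tauto|].
    simpl; f_equal; ring.
Qed.

(** Since [|v| + n + 1] bounds [|v + n|], this controls the defect of the truncated series in its
    differential equation. Consecutive terms have ratio at most [(|v| + n + 2) rho / (n + 1)], which
    eventually falls below the midpoint of [rho] and 1. *)
Lemma is_lim_seq_binom_remainder v rho : 0 <= rho < 1 ->
  is_lim_seq (fun n => (Cabs v + INR n + 1) * Cabs (binom_coef v n) * rho ^ n) 0.
Proof.
  intros Hr; set (c := Cabs v); pose proof (Cabs_ge0 v) as Hc; fold c in Hc.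
  destruct (INR_unbounded (2 * (c + 1) / (1 - rho))) as [N0 HN0].
  apply (is_lim_seq_ratio _ ((1 + rho) / 2) N0); [lra| |].
  - intros n; pose proof (pos_INR n).
    apply Rmult_le_pos; [apply Rmult_le_pos; [lra|apply Cabs_ge0]|apply pow_le; tauto].
  - intros n Hn; apply le_INR in Hn; pose proof (pos_INR n) as Hp.
    assert (E := Cabs_binom_coef_S v n).
    assert (T : Cabs (v + RtoC (INR n))%X <= c + INR n + 1).
    { eapply Rle_trans; [apply Cabs_add|]; rewrite Cabs_RtoC, Rabs_pos_eq by lra; fold c; lra. }
    assert (Hq : (c + INR n + 2) * rho <= (1 + rho) / 2 * (INR n + 1)).
    { assert (2 * (c + 1) / (1 - rho) * (1 - rho) = 2 * (c + 1)) by (field; lra).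
      assert (2 * (c + 1) <= INR n * (1 - rho)) by (rewrite <- H; apply Rmult_le_compat_r; lra).
      nra. }
    rewrite S_INR; simpl pow.
    pose proof (Cabs_ge0 (binom_coef v n)) as Hb; pose proof (pow_le rho n (proj1 Hr)) as Hrn.
    pose proof (Cabs_ge0 (binom_coef v (S n))) as HbS.
    set (b := Cabs (binom_coef v n)) in *; set (b' := Cabs (binom_coef v (S n))) in *.
    assert (X : (INR n + 1) * b' <= (c + INR n + 1) * b) by (rewrite E; apply Rmult_le_compat_r; lra).
    apply Rle_trans with ((1 + rho) / 2 * (INR n + 1) * (b' * rho ^ n)).
    + replace ((c + (INR n + 1) + 1) * b' * (rho * rho ^ n)) with ((c + INR n + 2) * rho * (b' * rho ^ n)) by ring.
      apply Rmult_le_compat_r; [nra|lra].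
    + replace ((1 + rho) / 2 * (INR n + 1) * (b' * rho ^ n)) with ((1 + rho) / 2 * (((INR n + 1) * b') * rho ^ n)) by ring.
      apply Rmult_le_compat_l; [lra|]. apply Rmult_le_compat_r; assumption.
Qed.

Lemma Cderiv_pown f x l n : Cderiv f x l ->
  Cderiv (fun t => Cpown (f t) (S n)) x ((RtoC (INR n) + 1) * Cpown (f x) n * l)%X.
Proof.
  intros H; induction n as [|n IH].
  - eapply Cderiv_eq; [apply (Cderiv_mul (fun _ => Cone) f); [apply Cderiv_const|exact H]|].
    simpl; change (RtoC 0) with Czero; ring.
  - eapply Cderiv_eq; [apply (Cderiv_mul _ _ _ _ _ IH H)|].
    rewrite RtoC_S; simpl Cpown; ring.
Qed.

(* The truncated series satisfies the differential equation (1 - z) y' = v y up to its last term. *)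
Lemma Cderiv_binom_sum v N f x l : Cderiv f x l ->
  exists d, Cderiv (fun t => binom_sum v N (f t)) x (d * l)%X /\
    ((1 - f x) * d)%X =
    (v * binom_sum v N (f x) - (v + RtoC (INR N)) * (binom_coef v N * Cpown (f x) N))%X.
Proof.
  intros H; induction N as [|N (d & Hd & E)].
  - exists Czero; split.
    + apply (Cderiv_ext (fun _ => binom_coef v 0 * Cone)%X); [reflexivity|].
      eapply Cderiv_eq; [apply Cderiv_const|ring].
    + simpl; change (RtoC 0) with Czero; unfold binom_sum; simpl; ring.
  - exists (d + binom_coef v (S N) * ((RtoC (INR N) + 1) * Cpown (f x) N))%X; split.
    + eapply Cderiv_eq.
      * apply Cderiv_add; [exact Hd|].
        apply (Cderiv_scal (binom_coef v (S N))), (Cderiv_pown f x l N H).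
      * ring.
    + assert (F := binom_coef_S v N).
      unfold binom_sum in *; simpl Cpartial_sum; simpl Cpown; rewrite RtoC_S.
      set (B := Cpartial_sum (fun n => binom_coef v n * Cpown (f x) n)%X N) in *.
      transitivity ((1 - f x) * d + (1 - f x) * (((RtoC (INR N) + 1) * binom_coef v (S N)) * Cpown (f x) N))%X; [ring|].
      transitivity (v * B - ((RtoC (INR N) + 1) * binom_coef v (S N)) * (Cpown (f x) N * f x))%X; [|ring].
      rewrite E, F; ring.
Qed.

(** * Uniform convergence of the binomial series on smaller discs *)

Lemma Cabs_one_sub z : 1 - Cabs z <= Cre (1 - z) /\ 1 - Cabs z <= Cabs (1 - z) <= 1 + Cabs z.
Proof.
  pose proof (Cre_le_abs z) as H; apply Rabs_le_between in H.
  pose proof (Cre_le_abs (1 - z)) as H'; apply Rabs_le_between in H'.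
  pose proof (Cabs_add 1 (- z)) as H2.
  assert (E : Cabs 1 = 1) by (change Cone with (RtoC 1); rewrite Cabs_RtoC; apply Rabs_R1).
  rewrite Cabs_opp, E in H2; change (1 + - z)%X with (1 - z)%X in H2.
  assert (Cre (1 - z) = 1 - Cre z) by reflexivity.
  lra.
Qed.

Lemma Cabs_pow_one_sub_bound v rho : 0 <= rho < 1 ->
  exists K, 0 < K /\ forall z, Cabs z <= rho -> Cabs (Cexp (v * Clog (1 - z))) <= K.
Proof.
  (* On this disc [|1 - z|] lies between [1 - rho] and 2, so [ln 2 - ln (1 - rho)] bounds the real
     part of the logarithm in modulus; the last 2 bounds the arctangent, as [PI / 2 <= 2]. *)
  intros Hr; exists (exp (Cabs v * (ln 2 - ln (1 - rho) + 2))); split; [apply exp_pos|].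
  intros z Hz; destruct (Cabs_one_sub z) as (H1 & H2 & H3).
  rewrite Cabs_exp.
  assert (exp_le : forall x y, x <= y -> exp x <= exp y).
  { intros x y [H| ->]; [left; apply exp_increasing, H|right; reflexivity]. }
  apply exp_le.
  apply Rle_trans with (Cabs (v * Clog (1 - z))%X);
    [eapply Rle_trans; [apply Rle_abs|apply Cre_le_abs]|].
  rewrite Cabs_mul; apply Rmult_le_compat_l; [apply Cabs_ge0|].
  rewrite Clog_right_half by lra.
  eapply Rle_trans; [apply Cabs_le_parts|]; simpl Cre; simpl Cim.
  apply Rplus_le_compat.
  - assert (ln (1 - rho) <= ln (Cabs (1 - z))) by (apply ln_le; lra).
    assert (ln (Cabs (1 - z)) <= ln 2) by (apply ln_le; lra).
    assert (ln (1 - rho) <= ln 1) by (apply ln_le; lra).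
    assert (ln 1 <= ln 2) by (apply ln_le; lra).
    rewrite ln_1 in *.
    apply Rabs_le_between; lra.
  - match goal with |- Rabs (atan ?q) <= _ => pose proof (atan_bound q) end.
    pose proof PI_4; apply Rabs_le_between; lra.
Qed.

Lemma binom_sum_0 v N : binom_sum v N 0 = Cone.
Proof.
  unfold binom_sum; induction N as [|N IH]; simpl.
  - unfold binom_coef; simpl. change (RtoC 1) with Cone; field. apply (RtoC_neq0 1); lra.
  - rewrite IH; ring.
Qed.

Lemma Clog_1 : Clog 1 = Czero.
Proof.
  rewrite Clog_right_half by (simpl; lra).
  change Cone with (RtoC 1); rewrite Cabs_RtoC, Rabs_R1, ln_1; simpl.
  unfold Rdiv; rewrite Rmult_0_l, atan_0; reflexivity.
Qed.

Lemma Cderiv_pow_one_sub v f x l : Cderiv f x l -> Cabs (f x) < 1 ->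
  Cderiv (fun t => Cexp (v * Clog (1 - f t))%X) x
    (Cexp (v * Clog (1 - f x)) * (v * (- l / (1 - f x))))%X.
Proof.
  intros H Hz; apply Cderiv_exp, Cderiv_scal, Cderiv_log.
  - eapply Cderiv_eq; [apply Cderiv_sub; [apply Cderiv_const|exact H]|ring].
  - pose proof (Cabs_one_sub (f x)); lra.
Qed.

(* D(t) = B_N(tw) (1 - tw)^v has D(0) = 1 and derivative - w (v+N) b_N (tw)^N (1 - tw)^{v-1}. *)
Lemma binomial_series_uniform v rho eps : 0 <= rho < 1 -> 0 < eps ->
  exists N0, forall N, (N0 <= N)%nat -> forall w, Cabs w <= rho ->
    Cabs (binom_sum v N w * Cexp (v * Clog (1 - w)) - 1)%X <= eps.
Proof.
  intros Hr Heps; destruct (Cabs_pow_one_sub_bound v rho Hr) as (K & HK & Hbound).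
  pose proof (is_lim_seq_binom_remainder v rho Hr) as HL; apply is_lim_seq_spec in HL.
  (* [K] bounds the power of [1 - t w], [1 - rho] bounds the divisor [1 - t w] from below, and the 2
     offsets the factor of [Cderiv_compare]. *)
  assert (Hd : 0 < eps * (1 - rho) / (2 * K)) by (apply Rdiv_lt_0_compat; nra).
  destruct (HL (mkposreal _ Hd)) as [N0 HN0]; exists N0; intros N HN w Hw.
  specialize (HN0 N HN); simpl in HN0; rewrite Rminus_0_r in HN0.
  pose proof (pos_INR N) as Hp; pose proof (Cabs_ge0 v) as Hv.
  set (b := binom_coef v N) in *.
  pose proof (Cabs_ge0 b) as Hb; pose proof (pow_le rho N (proj1 Hr)) as HrN.
  set (A := (Cabs v + INR N + 1) * Cabs b * rho ^ N) in *.
  assert (HA : 0 <= A) by (apply Rmult_le_pos; [nra|assumption]).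
  rewrite Rabs_pos_eq in HN0 by exact HA.
  set (f := fun t => (RtoC t * w)%X).
  assert (Hf : forall t, Cderiv f t w).
  { intros t; eapply Cderiv_eq; [apply Cderiv_mul; [apply Cderiv_RtoC|apply Cderiv_const]|cbv beta; ring]. }
  assert (Hft : forall t, 0 <= t <= 1 -> Cabs (f t) <= rho).
  { intros t Ht; unfold f; rewrite Cabs_mul, Cabs_RtoC, Rabs_pos_eq by lra.
    pose proof (Cabs_ge0 w); nra. }
  set (D := fun t => (binom_sum v N (f t) * Cexp (v * Clog (1 - f t)))%X).
  set (D' := fun t => (- (w * Cexp (v * Clog (1 - f t)) * ((v + RtoC (INR N)) * (b * Cpown (f t) N)) / (1 - f t)))%X).
  assert (HD : forall t, 0 <= t <= 1 -> Cderiv D t (D' t)).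
  { intros t Ht; specialize (Hft t Ht).
    destruct (Cderiv_binom_sum v N f t w (Hf t)) as (d & Hd1 & Hd2).
    eapply Cderiv_eq; [apply (Cderiv_mul _ _ _ _ _ Hd1 (Cderiv_pow_one_sub v f t w (Hf t) ltac:(lra)))|].
    assert (Hne : (1 - f t)%X <> Czero) by (apply neq0_of_Cre; pose proof (Cabs_one_sub (f t)); lra).
    unfold D'; fold b in Hd2.
    (* Isolating [(1 - f t) * d] lets the differential equation act: its term [v * binom_sum]
       cancels against the derivative of the power, and only the last term of the series
       survives. *)
    transitivity (w * Cexp (v * Clog (1 - f t)) * ((1 - f t) * d - v * binom_sum v N (f t)) / (1 - f t))%X;
      [field; exact Hne|rewrite Hd2; field; exact Hne]. }
  assert (HD' : forall t, 0 <= t <= 1 -> Cabs (D' t) <= K * A / (1 - rho)).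
  { intros t Ht; specialize (Hft t Ht); pose proof (Cabs_one_sub (f t)) as (_ & H1 & _).
    assert (Hne : (1 - f t)%X <> Czero) by (apply neq0_of_Cre; pose proof (Cabs_one_sub (f t)); lra).
    unfold D', Cdiv; rewrite Cabs_opp, !Cabs_mul, Cabs_pown, (Cabs_inv _ Hne).
    specialize (Hbound _ Hft).
    assert (Hvn : Cabs (v + RtoC (INR N))%X <= Cabs v + INR N + 1).
    { eapply Rle_trans; [apply Cabs_add|]; rewrite Cabs_RtoC, Rabs_pos_eq; lra. }
    assert (Hpw : Cabs (f t) ^ N <= rho ^ N) by (apply pow_incr; split; [apply Cabs_ge0|exact Hft]).
    pose proof (Cabs_ge0 w); pose proof (Cabs_ge0 (Cexp (v * Clog (1 - f t)))).
    pose proof (Cabs_ge0 (v + RtoC (INR N))); pose proof (pow_le _ N (Cabs_ge0 (f t))).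
    unfold Rdiv; apply Rmult_le_compat.
    - apply Rmult_le_pos; [apply Rmult_le_pos; assumption|].
      apply Rmult_le_pos; [assumption|apply Rmult_le_pos; assumption].
    - left; apply Rinv_0_lt_compat; lra.
    - replace (K * A) with (1 * K * ((Cabs v + INR N + 1) * (Cabs b * rho ^ N))) by (unfold A; ring).
      apply Rmult_le_compat.
      + apply Rmult_le_pos; assumption.
      + apply Rmult_le_pos; [assumption|apply Rmult_le_pos; assumption].
      + apply Rmult_le_compat; lra.
      + apply Rmult_le_compat; try assumption; [apply Rmult_le_pos; assumption|].
        apply Rmult_le_compat_l; assumption.
    - apply Rinv_le_contravar; lra. }
  pose proof (Cderiv_compare D D' (fun t => K * A / (1 - rho) * t) (fun _ => K * A / (1 - rho)) 0 1
    ltac:(lra) HD ltac:(intros t _; auto_derive; [trivial|ring]) HD') as HC.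
  assert (E0 : D 0 = Cone).
  { unfold D, f; change (RtoC 0) with Czero.
    replace (0 * w)%X with Czero by ring. rewrite binom_sum_0.
    replace (1 - 0)%X with Cone by ring. rewrite Clog_1.
    replace (v * 0)%X with Czero by ring. rewrite Cexp_0; ring. }
  assert (E1 : f 1 = w) by (unfold f; change (RtoC 1) with Cone; ring).
  rewrite E0 in HC; unfold D in HC; rewrite E1 in HC.
  eapply Rle_trans; [exact HC|].
  assert (K * A / (1 - rho) <= eps / 2).
  { apply Rmult_le_reg_r with (1 - rho); [lra|].
    assert (eps * (1 - rho) / (2 * K) * (2 * K) = eps * (1 - rho)) by (field; lra).
    replace (K * A / (1 - rho) * (1 - rho)) with (K * A) by (field; lra).
    nra. }
  lra.
Qed.

(** * Primitives of the terms *)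

(** For [Re p > 0] this is the integral of [Cexp (- (p * t))] over [t >= x], hence the minus sign in
    its derivative. *)
Definition exp_prim (p : Cplx) (x : R) : Cplx := (Cexp (- (p * RtoC x)) / p)%X.

Lemma Cderiv_scal_RtoC k x : Cderiv (fun t => k * RtoC t)%X x k.
Proof. eapply Cderiv_eq; [apply Cderiv_scal, Cderiv_RtoC|ring]. Qed.

Lemma Cderiv_exp_prim p x : p <> Czero -> Cderiv (exp_prim p) x (- Cexp (- (p * RtoC x)))%X.
Proof.
  intros Hp; apply (Cderiv_ext (fun t => Cinv p * Cexp (- (p * RtoC t)))%X).
  - intros t; unfold exp_prim; field; exact Hp.
  - eapply Cderiv_eq; [apply Cderiv_scal, Cderiv_exp, Cderiv_opp, Cderiv_scal_RtoC|cbv beta; field; exact Hp].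
Qed.

Lemma Cabs_exp_prim p x : p <> Czero -> Cabs (exp_prim p x) = / Cabs p * exp (- (Cre p * x)).
Proof.
  intros Hp; unfold exp_prim, Cdiv; rewrite Cabs_mul, Cabs_exp, Cabs_inv by exact Hp.
  simpl Cre; rewrite Rmult_comm; do 3 f_equal; ring.
Qed.

Lemma is_lim_exp_prim p : 0 < Cre p -> is_lim (fun x => Cabs (exp_prim p x)) p_infty 0.
Proof.
  intros Hp; apply (is_lim_ext (fun x => / Cabs p * exp (- (Cre p * x)))).
  - intros x; symmetry; apply Cabs_exp_prim, neq0_of_Cre, Hp.
  - replace (Finite 0) with (Rbar_mult (/ Cabs p) 0) by (simpl; f_equal; ring).
    apply is_lim_scal_l.
    apply (is_lim_comp exp (fun x => - (Cre p * x)) p_infty 0 m_infty).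
    + apply is_lim_exp_m.
    + replace m_infty with (Rbar_opp (Rbar_mult (Cre p) p_infty)).
      * apply is_lim_opp, is_lim_scal_l, is_lim_id.
      * rewrite (is_Rbar_mult_unique _ _ p_infty); [reflexivity|].
        apply is_Rbar_mult_sym, is_Rbar_mult_p_infty_pos, Hp.
    + exists 0; intros; discriminate.
Qed.

Definition sinh_prim (l a b : Cplx) (x : R) : Cplx :=
  (exp_prim (l - a - b) x - exp_prim (l - a + b) x - exp_prim (l + a - b) x + exp_prim (l + a + b) x)%X.

(** A common lower bound [m] instead of mere positivity: along the exponents [l_n] it grows linearly
    in [n], and the decay of the hypergeometric terms is read off from it. *)
Definition pos_quad (m : R) (l a b : Cplx) : Prop :=
  (m <= Cre (l - a - b) /\ m <= Cre (l - a + b)) /\ (m <= Cre (l + a - b) /\ m <= Cre (l + a + b)).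

Lemma pos_quad_neq0 m l a b : 0 < m -> pos_quad m l a b ->
  ((l - a - b)%X <> Czero /\ (l - a + b)%X <> Czero) /\ ((l + a - b)%X <> Czero /\ (l + a + b)%X <> Czero).
Proof. intros Hm [[H1 H2] [H3 H4]]; repeat split; apply neq0_of_Cre; lra. Qed.

(** Rational in [Cexp z], which lets [field] settle identities between hyperbolic sines. *)
Lemma Csinh_half z : Csinh z = ((Cexp z - Cinv (Cexp z)) / (1 + 1))%X.
Proof.
  unfold Csinh; rewrite Cexp_opp.
  replace (RtoC (1/2)) with (1 / (1 + 1))%X.
  - field; split; [apply Cexp_neq0|apply (neq0_of_Cre (1 + 1)); simpl; lra].
  - apply Cplx_eq; simpl; unfold Cnorm2; simpl; field.
Qed.

Lemma Cderiv_sinh_prim m l a b x : 0 < m -> pos_quad m l a b ->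
  Cderiv (sinh_prim l a b) x
    (- (RtoC 4 * (Csinh (a * RtoC x) * Csinh (b * RtoC x) * Cexp (- (l * RtoC x)))))%X.
Proof.
  intros Hm Hq; destruct (pos_quad_neq0 m l a b Hm Hq) as [[H1 H2] [H3 H4]].
  eapply Cderiv_eq.
  - apply Cderiv_add; [apply Cderiv_sub; [apply Cderiv_sub|]|]; apply Cderiv_exp_prim; assumption.
  - replace (- ((l - a - b) * RtoC x))%X with (a * RtoC x + b * RtoC x + - (l * RtoC x))%X by ring.
    replace (- ((l - a + b) * RtoC x))%X with (a * RtoC x + - (b * RtoC x) + - (l * RtoC x))%X by ring.
    replace (- ((l + a - b) * RtoC x))%X with (- (a * RtoC x) + b * RtoC x + - (l * RtoC x))%X by ring.
    replace (- ((l + a + b) * RtoC x))%X with (- (a * RtoC x) + - (b * RtoC x) + - (l * RtoC x))%X by ring.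
    rewrite !Csinh_half, !Cexp_add, !(Cexp_opp (a * RtoC x)), !(Cexp_opp (b * RtoC x)).
    replace (RtoC 4) with ((1 + 1) * (1 + 1))%X by (apply Cplx_eq; simpl; ring).
    field; repeat split; try apply Cexp_neq0.
    apply (neq0_of_Cre (1 + 1)); simpl; lra.
Qed.

Lemma is_lim_sinh_prim m l a b : 0 < m -> pos_quad m l a b ->
  is_lim (fun x => Cabs (sinh_prim l a b x)) p_infty 0.
Proof.
  intros Hm [[H1 H2] [H3 H4]].
  apply (is_lim_le_le_loc (fun _ => 0) (fun x => Cabs (exp_prim (l - a - b) x) + Cabs (exp_prim (l - a + b) x)
    + Cabs (exp_prim (l + a - b) x) + Cabs (exp_prim (l + a + b) x))).
  - exists 0; intros x _; split; [apply Cabs_ge0|unfold sinh_prim].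
    eapply Rle_trans; [apply Cabs_add|apply Rplus_le_compat_r].
    eapply Rle_trans; [apply Cabs_add|rewrite Cabs_opp; apply Rplus_le_compat_r].
    eapply Rle_trans; [apply Cabs_add|rewrite Cabs_opp; apply Rle_refl].
  - apply is_lim_const.
  - replace (Finite 0) with (Finite (0 + 0 + 0 + 0)) by (f_equal; ring).
    repeat apply is_lim_plus'; apply is_lim_exp_prim; lra.
Qed.

(** sinh vanishes at 0, and the derivative [a cosh(at)] has modulus at most [|a| e^(|a| x)] on
    [[0, x]]. The factor [x] is the point: two of them give the [x^2] behind the cubic decay. The 2
    comes from [Cderiv_compare]. *)
Lemma Cabs_sinh_le a x : 0 <= x -> Cabs (Csinh (a * RtoC x)) <= 2 * Cabs a * x * exp (Cabs a * x).
Proof.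
  intros Hx.
  set (f' := fun t => (a * (RtoC (1/2) * (Cexp (a * RtoC t) + Cexp (- (a * RtoC t)))))%X).
  assert (Hf : forall t, Cderiv (fun t => Csinh (a * RtoC t)) t (f' t)).
  { intros t; eapply Cderiv_eq.
    - apply Cderiv_scal, Cderiv_sub; apply Cderiv_exp; [|apply Cderiv_opp]; apply Cderiv_scal_RtoC.
    - cbv beta; unfold f'; ring. }
  assert (Hexp : forall z t, 0 <= t <= x -> Cabs z = Cabs a -> Cabs (Cexp (z * RtoC t)) <= exp (Cabs a * x)).
  { intros z t Ht E; rewrite Cabs_exp; simpl.
    pose proof (Cre_le_abs z) as Hz; apply Rabs_le_between in Hz; pose proof (Cabs_ge0 a).
    assert (Hle : Cre z * t - Cim z * 0 <= Cabs a * x) by nra.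
    destruct Hle as [Hlt| ->]; [left; apply exp_increasing, Hlt|right; reflexivity]. }
  pose proof (Cderiv_compare (fun t => Csinh (a * RtoC t)) f' (fun t => Cabs a * exp (Cabs a * x) * t)
    (fun _ => Cabs a * exp (Cabs a * x)) 0 x Hx (fun t _ => Hf t)
    ltac:(intros t _; auto_derive; [trivial|ring])) as HC.
  cbv beta in HC.
  replace (Csinh (a * RtoC 0)) with Czero in HC.
  - replace (Csinh (a * RtoC x) - 0)%X with (Csinh (a * RtoC x)) in HC by ring.
    eapply Rle_trans; [apply HC|right; ring].
    intros t Ht; unfold f'; rewrite Cabs_mul; apply Rmult_le_compat_l; [apply Cabs_ge0|].
    rewrite Cabs_mul, Cabs_RtoC, Rabs_pos_eq by lra.
    pose proof (Cabs_add (Cexp (a * RtoC t)) (Cexp (- (a * RtoC t)))).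
    pose proof (Hexp a t Ht eq_refl).
    pose proof (Hexp (- a)%X t Ht (Cabs_opp a)) as Hm.
    replace (- a * RtoC t)%X with (- (a * RtoC t))%X in Hm by ring. lra.
  - change (RtoC 0) with Czero; replace (a * 0)%X with Czero by ring.
    rewrite Csinh_half, Cexp_0; field.
    split; [apply (neq0_of_Cre 1); simpl; lra|apply (neq0_of_Cre (1 + 1)); simpl; lra].
Qed.

(** The primitive found by two integrations by parts; it equals [- 2 / k^3] at 0 and tends to 0 at
    infinity. *)
Lemma is_derive_sqr_exp k t : 0 < k ->
  is_derive (fun t => - ((t * t / k + 2 * t / (k * k) + 2 / (k * k * k)) * exp (- (k * t)))) t
    (t * t * exp (- (k * t))).
Proof.
  intros Hk; auto_derive; [repeat split; nra|]. field; lra.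
Qed.

(* Integrate |4 sinh(at) sinh(bt) e^{-lt}| <= 16 |a b| t^2 e^{-kt} from x to y, then let y tend to infinity. *)
Lemma Cabs_sinh_prim_le l a b x k : 0 <= x -> 0 < k -> k <= Cre l - Cabs a - Cabs b ->
  Cabs (sinh_prim l a b x) <= 64 * (Cabs a * Cabs b) / (k * k * k).
Proof.
  intros Hx Hk Hl.
  assert (Hq : pos_quad k l a b).
  { pose proof (Cre_le_abs a) as Ha; pose proof (Cre_le_abs b) as Hb.
    apply Rabs_le_between in Ha; apply Rabs_le_between in Hb.
    unfold pos_quad; simpl; lra. }
  set (h := fun t => - ((t * t / k + 2 * t / (k * k) + 2 / (k * k * k)) * exp (- (k * t)))).
  set (h' := fun t => t * t * exp (- (k * t))).
  set (A := 16 * (Cabs a * Cabs b)).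
  assert (HA : 0 <= A) by (pose proof (Cabs_ge0 a); pose proof (Cabs_ge0 b); unfold A; nra).
  assert (Hh : forall t, is_derive h t (h' t)) by (intros t; apply is_derive_sqr_exp, Hk).
  assert (Hh0 : h 0 = - (2 / (k * k * k))).
  { unfold h; replace (- (k * 0)) with 0 by ring; rewrite exp_0; field; lra. }
  assert (Hhx : h 0 <= h x).
  { pose proof (deriv_compare (fun _ => 0) (fun _ => 0) h h' 0 x Hx
      ltac:(intros; auto_derive; trivial) (fun t _ => Hh t)
      ltac:(intros t Ht; unfold h'; pose proof (exp_pos (- (k * t))); nra)); lra. }
  assert (Hdiff : forall y, x <= y -> Cabs (sinh_prim l a b y - sinh_prim l a b x) <= 64 * (Cabs a * Cabs b) / (k * k * k)).
  { intros y Hy.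
    eapply Rle_trans; [apply (Cderiv_compare (sinh_prim l a b) _ (fun t => A * h t) (fun t => A * h' t) x y Hy
      (fun t _ => Cderiv_sinh_prim k l a b t Hk Hq))|].
    - intros t _; apply is_derive_scal, Hh.
    - intros t Ht; unfold h'.
      pose proof (Cabs_sinh_le a t ltac:(lra)) as Sa; pose proof (Cabs_sinh_le b t ltac:(lra)) as Sb.
      rewrite Cabs_opp, !Cabs_mul, Cabs_RtoC, Rabs_pos_eq, Cabs_exp by lra.
      pose proof (Cabs_ge0 (Csinh (a * RtoC t))); pose proof (Cabs_ge0 (Csinh (b * RtoC t))).
      apply Rle_trans with (4 * ((2 * Cabs a * t * exp (Cabs a * t)) * (2 * Cabs b * t * exp (Cabs b * t)) * exp (- (Cre l * t)))).
      + apply Rmult_le_compat_l; [lra|]. apply Rmult_le_compat.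
        * apply Rmult_le_pos; assumption.
        * left; apply exp_pos.
        * apply Rmult_le_compat; assumption.
        * right; f_equal; simpl; ring.
      + replace (4 * ((2 * Cabs a * t * exp (Cabs a * t)) * (2 * Cabs b * t * exp (Cabs b * t)) * exp (- (Cre l * t))))
          with (A * (t * t * (exp (Cabs a * t) * exp (Cabs b * t) * exp (- (Cre l * t))))) by (unfold A; ring).
        apply Rmult_le_compat_l; [exact HA|].
        apply Rmult_le_compat_l; [nra|].
        rewrite <- !exp_plus.
        assert (Hle : Cabs a * t + Cabs b * t + - (Cre l * t) <= - (k * t)) by nra.
        destruct Hle as [Hlt| ->]; [left; apply exp_increasing, Hlt|right; reflexivity].
    - assert (h y <= 0).
      { unfold h; pose proof (exp_pos (- (k * y))).
        assert (0 <= y * y / k) by (apply Rdiv_le_0_compat; nra).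
        assert (0 <= 2 * y / (k * k)) by (apply Rdiv_le_0_compat; nra).
        assert (0 <= 2 / (k * k * k)) by (apply Rdiv_le_0_compat; [lra|repeat apply Rmult_lt_0_compat; lra]).
        nra. }
      (* [64 = 2 * 16 * 2]: the factor of [Cderiv_compare], then [4 * 2 * 2] inside [A] from the two
         bounds on sinh, then the integral [2 / k^3] of [t^2 e^(-kt)] over the half-line. *)
      replace (64 * (Cabs a * Cabs b) / (k * k * k)) with (2 * (A * (2 / (k * k * k)))) by (unfold A; field; lra).
      rewrite <- Rmult_minus_distr_l.
      apply Rmult_le_compat_l; [lra|]. apply Rmult_le_compat_l; [exact HA|lra]. }
  apply le_epsilon; intros eps Heps.
  pose proof (is_lim_sinh_prim k l a b Hk Hq) as HL; apply is_lim_spec in HL.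
  destruct (HL (mkposreal eps Heps)) as [B HB]; simpl in HB.
  set (y := Rmax x (B + 1)).
  pose proof (Rmax_l x (B + 1)); pose proof (Rmax_r x (B + 1)).
  specialize (HB y ltac:(unfold y; lra)); specialize (Hdiff y ltac:(unfold y; lra)).
  rewrite Rminus_0_r, Rabs_pos_eq in HB by apply Cabs_ge0.
  replace (sinh_prim l a b x) with (sinh_prim l a b y + - (sinh_prim l a b y - sinh_prim l a b x))%X by ring.
  eapply Rle_trans; [apply Cabs_add|]; rewrite Cabs_opp; lra.
Qed.

Lemma Cabs_sinh_prim_le_inv m l a b x : 0 <= x -> 0 < m -> pos_quad m l a b ->
  Cabs (sinh_prim l a b x) <= 4 / m.
Proof.
  intros Hx Hm [[H1 H2] [H3 H4]].
  assert (E : forall p, m <= Cre p -> Cabs (exp_prim p x) <= / m).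
  { intros p Hp; rewrite Cabs_exp_prim by (apply neq0_of_Cre; lra).
    pose proof (Cre_le_abs p) as Hr; apply Rabs_le_between in Hr.
    rewrite <- (Rmult_1_r (/ m)); apply Rmult_le_compat.
    - left; apply Rinv_0_lt_compat; lra.
    - left; apply exp_pos.
    - apply Rinv_le_contravar; lra.
    - rewrite <- exp_0. assert (Hle : - (Cre p * x) <= 0) by nra.
      destruct Hle as [Hlt| ->]; [left; apply exp_increasing, Hlt|right; reflexivity]. }
  unfold sinh_prim.
  eapply Rle_trans; [apply Cabs_add|].
  apply Rle_trans with (/ m + / m + / m + / m); [|right; field; lra].
  apply Rplus_le_compat; [|apply E; assumption].
  eapply Rle_trans; [apply Cabs_add|rewrite Cabs_opp; apply Rplus_le_compat; [|apply E; assumption]].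
  eapply Rle_trans; [apply Cabs_add|rewrite Cabs_opp; apply Rplus_le_compat; apply E; assumption].
Qed.

(** * The exponents [l_n] and decay estimates along them *)

Definition freq (v c : Cplx) (n : nat) : Cplx := ((v + RtoC 2 * RtoC (INR n)) * c)%X.

(** At [n = 0] the four real parts are those assumed positive, and each further step adds [2 Re c];
    including [Re c] in the minimum [m] makes one constant serve all [n]. *)
Lemma pos_quad_freq v c a b : 0 < Cre c ->
  0 < Cre (v * c - a - b) -> 0 < Cre (v * c - a + b) ->
  0 < Cre (v * c + a - b) -> 0 < Cre (v * c + a + b) ->
  exists m, 0 < m /\ forall n, pos_quad (m * (INR n + 1)) (freq v c n) a b.
Proof.
  intros Hc H1 H2 H3 H4.
  set (m := Rmin (Rmin (Rmin (Cre (v * c - a - b)) (Cre (v * c - a + b)))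
    (Rmin (Cre (v * c + a - b)) (Cre (v * c + a + b)))) (Cre c)).
  exists m; split; [repeat apply Rmin_pos; assumption|]; intros n.
  assert (Hm : (m <= Cre (v * c - a - b) /\ m <= Cre (v * c - a + b)) /\
    (m <= Cre (v * c + a - b) /\ m <= Cre (v * c + a + b)) /\ m <= Cre c).
  { unfold m; repeat split;
    repeat first [apply Rle_refl | apply Rmin_r
      | eapply Rle_trans; [apply Rmin_l|]; apply Rmin_l
      | eapply Rle_trans; [apply Rmin_l|]; apply Rmin_r
      | eapply Rle_trans; [apply Rmin_l|]; eapply Rle_trans; [apply Rmin_l|]; first [apply Rmin_l|apply Rmin_r]
      | eapply Rle_trans; [apply Rmin_l|]; eapply Rle_trans; [apply Rmin_r|]; first [apply Rmin_l|apply Rmin_r]]. }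
  destruct Hm as ((A1 & A2) & (A3 & A4) & A5).
  clearbody m; pose proof (pos_INR n) as Hn.
  unfold pos_quad, freq; simpl in *.
  assert (m * INR n <= Cre c * INR n) by nra.
  assert (0 <= Cre c * INR n) by nra.
  repeat split; nra.
Qed.

Lemma cube_pochhammer_pos n : 0 < (INR n + 1) * (INR n + 2) * (INR n + 3).
Proof. pose proof (pos_INR n); repeat apply Rmult_lt_0_compat; lra. Qed.

Lemma Cabs_sinh_prim_freq v c a b m : 0 < Cre c -> 0 < m ->
  (forall n, pos_quad (m * (INR n + 1)) (freq v c n) a b) ->
  exists K, forall n x, 0 <= x ->
    Cabs (sinh_prim (freq v c n) a b x) <= K / ((INR n + 1) * (INR n + 2) * (INR n + 3)).
Proof.
  intros Hc Hm Hq; set (r := Cre c) in *.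
  (* From this index on, [k = r (n + 3)] satisfies [k <= Re l_n - |a| - |b|], because
     [Re l_n = Re (v c) + 2 n r]. The shift by 3 makes [k^3] dominate
     [r^3 (n + 1)(n + 2)(n + 3)]. *)
  destruct (INR_unbounded ((3 * r + Cabs a + Cabs b - Cre (v * c)) / r)) as [N0 HN0].
  assert (HN0' : 3 * r + Cabs a + Cabs b - Cre (v * c) <= INR N0 * r).
  { replace (3 * r + Cabs a + Cabs b - Cre (v * c)) with ((3 * r + Cabs a + Cabs b - Cre (v * c)) / r * r) by (field; lra).
    apply Rmult_le_compat_r; lra. }
  set (K1 := 64 * (Cabs a * Cabs b) / (r * r * r)).
  set (K2 := 4 / m * ((INR N0 + 1) * (INR N0 + 2) * (INR N0 + 3))).
  assert (HK1 : 0 <= K1).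
  { apply Rdiv_le_0_compat; [|repeat apply Rmult_lt_0_compat; lra].
    pose proof (Cabs_ge0 a); pose proof (Cabs_ge0 b); nra. }
  assert (HK2 : 0 <= K2).
  { apply Rmult_le_pos; [apply Rdiv_le_0_compat; lra|left; apply cube_pochhammer_pos]. }
  exists (K1 + K2); intros n x Hx; pose proof (pos_INR n) as Hn; pose proof (cube_pochhammer_pos n) as Hcu.
  apply Rmult_le_reg_r with ((INR n + 1) * (INR n + 2) * (INR n + 3)); [exact Hcu|].
  replace ((K1 + K2) / ((INR n + 1) * (INR n + 2) * (INR n + 3)) * ((INR n + 1) * (INR n + 2) * (INR n + 3)))
    with (K1 + K2) by (field; lra).
  destruct (Nat.le_gt_cases N0 n) as [Hge|Hlt].
  - apply le_INR in Hge.
    assert (Hk : 0 < r * (INR n + 3)) by nra.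
    eapply Rle_trans; [apply Rmult_le_compat_r; [lra|]; apply (Cabs_sinh_prim_le _ a b x (r * (INR n + 3)) Hx Hk)|].
    + unfold freq; simpl in *; fold r; fold r in HN0'. nra.
    + replace (64 * (Cabs a * Cabs b) / (r * (INR n + 3) * (r * (INR n + 3)) * (r * (INR n + 3))))
        with (K1 / ((INR n + 3) * (INR n + 3) * (INR n + 3))) by (unfold K1; field; lra).
      assert (Hc3 : 0 < (INR n + 3) * (INR n + 3) * (INR n + 3)) by (repeat apply Rmult_lt_0_compat; lra).
      apply Rle_trans with (K1 / ((INR n + 3) * (INR n + 3) * (INR n + 3)) * ((INR n + 3) * (INR n + 3) * (INR n + 3))).
      * apply Rmult_le_compat_l; [apply Rdiv_le_0_compat; assumption|].
        apply Rmult_le_compat_r; [lra|]. apply Rmult_le_compat; lra.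
      * replace (K1 / ((INR n + 3) * (INR n + 3) * (INR n + 3)) * ((INR n + 3) * (INR n + 3) * (INR n + 3)))
          with K1 by (field; lra). lra.
  - apply Nat.lt_le_incl, le_INR in Hlt.
    apply Rle_trans with K2; [|lra]. unfold K2; apply Rmult_le_compat; [apply Cabs_ge0|lra| |].
    + apply (Cabs_sinh_prim_le_inv m); try assumption.
      pose proof (Hq n) as Hqn; unfold pos_quad in *.
      assert (m <= m * (INR n + 1)) by nra. lra.
    + apply Rmult_le_compat; [nra|lra| |lra]. apply Rmult_le_compat; lra.
Qed.

(** * Identification with the hypergeometric series *)

(** Both sides are [(s)_(n+1)], with the first or the last factor split off; without division this
    also covers [s = 0]. *)
Lemma Cpoch_shift s n : (Cpoch (1 + s) n * s)%X = (Cpoch s n * (s + RtoC (INR n)))%X.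
Proof.
  induction n as [|n IH].
  - simpl; change (RtoC 0) with Czero; ring.
  - rewrite RtoC_S; simpl Cpoch.
    transitivity ((Cpoch (1 + s) n * s) * (1 + s + RtoC (INR n)))%X; [ring|].
    rewrite IH; ring.
Qed.

Lemma Cpoch_neq0 z n : not_nonpos_int z -> Cpoch z n <> Czero.
Proof.
  intros Hz; induction n as [|n IH]; simpl.
  - apply (RtoC_neq0 1); lra.
  - intros E.
    assert (Hn : (z + RtoC (INR n))%X <> Czero).
    { intros E'; apply (Hz n).
      apply Cplx_eq; [apply (f_equal Cre) in E'|apply (f_equal Cim) in E']; simpl in *; lra. }
    apply IH.
    transitivity (Cpoch z n * (z + RtoC (INR n)) / (z + RtoC (INR n)))%X; [field; exact Hn|].
    rewrite E; field; exact Hn.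
Qed.

Lemma Cpown_1 n : Cpown 1 n = Cone.
Proof. induction n as [|n IH]; simpl; [reflexivity|rewrite IH; ring]. Qed.

(** Nonvanishing of [s + n] is a separate condition because the one on [1 + s] leaves [s = 0]
    possible. *)
Lemma Cpoch_ratio s n : not_nonpos_int (1 + s)%X -> (s + RtoC (INR n))%X <> Czero ->
  (Cpoch s n / Cpoch (1 + s) n)%X = (s / (s + RtoC (INR n)))%X.
Proof.
  intros Hs Hn; pose proof (Cpoch_neq0 _ n Hs) as Hp.
  transitivity ((Cpoch s n * (s + RtoC (INR n))) / (Cpoch (1 + s) n * (s + RtoC (INR n))))%X; [field; tauto|].
  rewrite <- Cpoch_shift; field; tauto.
Qed.

(** Every upper parameter except [v] is matched with a lower one differing from it by 1, so the
    Pochhammer quotients collapse to rational functions of [n]; [(v)_n] and [n!] are left to form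
    the binomial coefficient. *)
Lemma hyp_term_split (v v2 s3 s4 s5 s6 : Cplx) (n : nat) :
  not_nonpos_int v2 -> not_nonpos_int (1 + s3)%X -> not_nonpos_int (1 + s4)%X ->
  not_nonpos_int (1 + s5)%X -> not_nonpos_int (1 + s6)%X ->
  (s3 + RtoC (INR n))%X <> Czero -> (s4 + RtoC (INR n))%X <> Czero ->
  (s5 + RtoC (INR n))%X <> Czero -> (s6 + RtoC (INR n))%X <> Czero ->
  pFq_term [v; (1 + v2)%X; s3; s5; s4; s6]
           [v2; (1 + s3)%X; (1 + s5)%X; (1 + s4)%X; (1 + s6)%X] 1%X n =
  (binom_coef v n * ((v2 + RtoC (INR n)) / v2) * (s3 / (s3 + RtoC (INR n)))
    * (s4 / (s4 + RtoC (INR n))) * (s5 / (s5 + RtoC (INR n))) * (s6 / (s6 + RtoC (INR n))))%X.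
Proof.
  intros H2 H3 H4 H5 H6 N3 N4 N5 N6.
  rewrite <- (Cpoch_ratio s3 n), <- (Cpoch_ratio s4 n), <- (Cpoch_ratio s5 n), <- (Cpoch_ratio s6 n) by assumption.
  assert (Hv2 : v2 <> Czero).
  { intros E; apply (H2 0%nat); rewrite E; apply Cplx_eq; simpl; ring. }
  pose proof (Cpoch_neq0 _ n H2) as P2.
  replace ((v2 + RtoC (INR n)) / v2)%X with (Cpoch (1 + v2) n / Cpoch v2 n)%X.
  - unfold pFq_term, binom_coef; simpl; rewrite Cpown_1.
    field; repeat split; first [apply fact_Cplx_neq0|apply Cpoch_neq0; assumption].
  - transitivity ((Cpoch (1 + v2) n * v2) / (Cpoch v2 n * v2))%X; [field; tauto|].
    rewrite Cpoch_shift; field; tauto.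
Qed.

Lemma RtoC_2_neq0 : RtoC 2 <> Czero.
Proof. apply RtoC_neq0; lra. Qed.

(** The product of the four quotients [s_j / (s_j + n)] of the hypergeometric term, after cancelling
    [2c]. *)
Definition factor_quotient (v a b c : Cplx) (n : nat) : Cplx :=
  ((v * c - a - b) / (freq v c n - a - b) * ((v * c - a + b) / (freq v c n - a + b))
   * ((v * c + a + b) / (freq v c n + a + b)) * ((v * c + a - b) / (freq v c n + a - b)))%X.

(** Each [s_j] is some [q / (2c)], and [s_j + n] is then the matching denominator of the primitive
    at 0 over [2c]: this is how the two series meet. *)
Lemma ratio_shift (c s q p k : Cplx) : c <> Czero -> p <> Czero ->
  s = (q / (RtoC 2 * c))%X -> p = (q + RtoC 2 * k * c)%X ->
  (s + k)%X <> Czero /\ (s / (s + k))%X = (q / p)%X.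
Proof.
  intros Hc Hp -> E; pose proof RtoC_2_neq0 as H2.
  assert (F : (q / (RtoC 2 * c) + k)%X = (p / (RtoC 2 * c))%X) by (rewrite E; field; tauto).
  rewrite F; split.
  - intros Z; apply Hp.
    transitivity (p / (RtoC 2 * c) * (RtoC 2 * c))%X; [field; tauto|rewrite Z; ring].
  - field; tauto.
Qed.

Lemma Cabs_ratio_le q p m y : 0 < m -> 0 < y -> m * y <= Cre p -> Cabs (q / p) <= Cabs q / m / y.
Proof.
  intros Hm Hy Hp; unfold Cdiv.
  pose proof (Cre_le_abs p) as Hr; apply Rabs_le_between in Hr.
  assert (0 < m * y) by (apply Rmult_lt_0_compat; assumption).
  rewrite Cabs_mul, Cabs_inv by (apply neq0_of_Cre; lra).
  replace (Cabs q / m / y) with (Cabs q * / (m * y)) by (field; lra).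
  apply Rmult_le_compat_l; [apply Cabs_ge0|apply Rinv_le_contravar; lra].
Qed.

Lemma Cabs_factor_quotient_le v a b c m n : 0 < m -> pos_quad (m * (INR n + 1)) (freq v c n) a b ->
  Cabs (factor_quotient v a b c n) <=
  Cabs (v * c - a - b) / m * (Cabs (v * c - a + b) / m) * (Cabs (v * c + a + b) / m) * (Cabs (v * c + a - b) / m)
  / ((INR n + 1) * (INR n + 1) * (INR n + 1) * (INR n + 1)).
Proof.
  intros Hm [[H1 H2] [H3 H4]]; pose proof (pos_INR n) as Hn.
  assert (Hy : 0 < INR n + 1) by lra.
  unfold factor_quotient; rewrite !Cabs_mul.
  match goal with |- _ <= ?A * ?B * ?C * ?D / _ =>
    replace (A * B * C * D / ((INR n + 1) * (INR n + 1) * (INR n + 1) * (INR n + 1)))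
    with (A / (INR n + 1) * (B / (INR n + 1)) * (C / (INR n + 1)) * (D / (INR n + 1))) by (field; lra) end.
  repeat apply Rmult_le_compat; repeat apply Rmult_le_pos; try apply Cabs_ge0; apply Cabs_ratio_le; assumption.
Qed.

(** * The integrand, its differentiability and its expansion *)

Lemma Cexp_freq v c n x :
  Cexp (- (freq v c n * RtoC x)) =
  (Cexp (- (v * (c * RtoC x))) * Cpown (Cexp (RtoC (-2) * (c * RtoC x))) n)%X.
Proof.
  unfold freq; induction n as [|n IH].
  - simpl; change (RtoC 0) with Czero.
    replace (- ((v + RtoC 2 * 0) * c * RtoC x))%X with (- (v * (c * RtoC x)))%X by ring; ring.
  - rewrite RtoC_S; simpl Cpown.
    replace (- ((v + RtoC 2 * (RtoC (INR n) + 1)) * c * RtoC x))%X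
      with (- ((v + RtoC 2 * RtoC (INR n)) * c * RtoC x) + RtoC (-2) * (c * RtoC x))%X.
    + rewrite Cexp_add, IH; ring.
    + replace (RtoC (-2)) with (- RtoC 2)%X by (apply Cplx_eq; simpl; ring). ring.
Qed.

(** [sinh_cpow] is a product of exponentials, hence never 0; inverting each of them gives a form fit
    both for differentiation and for expanding [(1 - w)^(-v)] with [w = e^(-2cx)]. *)
Lemma integrand_eq v a b c x :
  (Csinh (a * RtoC x) * Csinh (b * RtoC x) / sinh_cpow c v x)%X =
  (Cexp (v * RtoC (ln 2)) * (Csinh (a * RtoC x) * Csinh (b * RtoC x) * Cexp (- (v * (c * RtoC x))))
    * Cexp (- (v * Clog (1 - Cexp (RtoC (-2) * (c * RtoC x))))))%X.
Proof.
  unfold sinh_cpow, Cpow.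
  replace (- v * RtoC (ln 2))%X with (- (v * RtoC (ln 2)))%X by ring.
  rewrite !Cexp_opp; field; repeat split; apply Cexp_neq0.
Qed.

Lemma Cabs_exp_decay c x e : 0 < Cre c -> e <= x ->
  Cabs (Cexp (RtoC (-2) * (c * RtoC x))) <= exp (- (2 * Cre c * e)).
Proof.
  intros Hc Hx; rewrite Cabs_exp; simpl.
  match goal with |- exp ?u <= exp ?w => assert (Hle : u <= w) by nra end.
  destruct Hle as [Hlt| ->]; [left; apply exp_increasing, Hlt|right; reflexivity].
Qed.

Lemma exp_decay_lt1 c e : 0 < c -> 0 < e -> 0 <= exp (- (2 * c * e)) < 1.
Proof.
  intros Hc He; split; [left; apply exp_pos|].
  apply Rlt_le_trans with (exp 0); [apply exp_increasing; nra|right; apply exp_0].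
Qed.

Lemma Cderiv_integrand v a b c x : 0 < Cre c -> 0 < x ->
  exists l, Cderiv (fun x => Csinh (a * RtoC x) * Csinh (b * RtoC x) / sinh_cpow c v x)%X x l.
Proof.
  intros Hc Hx; eexists.
  eapply Cderiv_ext; [intros t; symmetry; apply integrand_eq|].
  assert (Hs : forall d, Cderiv (fun x => Csinh (d * RtoC x)) x
    (RtoC (1/2) * (Cexp (d * RtoC x) * d - Cexp (- (d * RtoC x)) * - d))%X).
  { intros d; apply Cderiv_scal, Cderiv_sub; apply Cderiv_exp; [|apply Cderiv_opp]; apply Cderiv_scal_RtoC. }
  apply Cderiv_mul.
  - apply Cderiv_scal, Cderiv_mul; [apply Cderiv_mul; apply Hs|].
    apply Cderiv_exp, Cderiv_opp, Cderiv_scal, Cderiv_scal_RtoC.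
  - apply Cderiv_exp, Cderiv_opp, Cderiv_scal, Cderiv_log.
    + apply Cderiv_sub; [apply Cderiv_const|apply Cderiv_exp, Cderiv_scal, Cderiv_scal_RtoC].
    + pose proof (Cabs_exp_decay c x x Hc (Rle_refl x)).
      pose proof (exp_decay_lt1 (Cre c) x Hc Hx).
      pose proof (Cabs_one_sub (Cexp (RtoC (-2) * (c * RtoC x)))). lra.
Qed.

Lemma Cabs_bounded_on_segment (f : R -> Cplx) e t : e <= t ->
  (forall x, e <= x <= t -> exists l, Cderiv f x l) ->
  exists B, forall x, e <= x <= t -> Cabs (f x) <= B.
Proof.
  intros Het Hf.
  destruct (continuity_ab_maj (fun x => Rabs (Cre (f x)) + Rabs (Cim (f x))) e t Het) as [x0 [Hx0 _]].
  - intros x Hx; destruct (Hf x Hx) as [l Hl]; destruct (Cderiv_continuous _ _ _ Hl) as [C1 C2].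
    apply continuity_pt_filterlim.
    apply (continuous_plus (fun x => Rabs (Cre (f x))) (fun x => Rabs (Cim (f x))));
      apply continuous_comp; try assumption; apply continuous_Rabs.
  - exists (Rabs (Cre (f x0)) + Rabs (Cim (f x0))); intros x Hx.
    eapply Rle_trans; [apply Cabs_le_parts|apply Hx0, Hx].
Qed.

Lemma Cpartial_sum_scal k f N :
  Cpartial_sum (fun n => k * f n)%X N = (k * Cpartial_sum f N)%X.
Proof. induction N as [|N IH]; simpl; [reflexivity|rewrite IH; ring]. Qed.

(** [binomial_series_uniform] controls the relative error; multiplied by the integrand, which is
    bounded on [[e, t]], it becomes an absolute one. *)
Lemma integrand_expansion v a b c e t eps : 0 < Cre c -> 0 < e -> e <= t -> 0 < eps ->
  exists N0, forall N, (N0 <= N)%nat -> forall x, e <= x <= t ->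
  Cabs (Csinh (a * RtoC x) * Csinh (b * RtoC x) / sinh_cpow c v x
    - Cpartial_sum (fun n => Cexp (v * RtoC (ln 2)) * (Csinh (a * RtoC x) * Csinh (b * RtoC x) * Cexp (- (v * (c * RtoC x))))
        * (binom_coef v n * Cpown (Cexp (RtoC (-2) * (c * RtoC x))) n)) N)%X <= eps.
Proof.
  intros Hc He Het Heps.
  destruct (Cabs_bounded_on_segment (fun x => Csinh (a * RtoC x) * Csinh (b * RtoC x) / sinh_cpow c v x)%X e t Het)
    as [B HB]; [intros x Hx; apply Cderiv_integrand; lra|].
  assert (HB0 : 0 <= B) by (eapply Rle_trans; [apply Cabs_ge0|apply (HB e); lra]).
  assert (Hd : 0 < eps / (B + 1)) by (apply Rdiv_lt_0_compat; lra).
  destruct (binomial_series_uniform v (exp (- (2 * Cre c * e))) (eps / (B + 1))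
    (exp_decay_lt1 _ _ Hc He) Hd) as [N0 HN0].
  exists N0; intros N HN x Hx.
  specialize (HN0 N HN _ (Cabs_exp_decay c x e Hc (proj1 Hx))); specialize (HB x Hx); cbv beta in HB.
  rewrite Cpartial_sum_scal; fold (binom_sum v N (Cexp (RtoC (-2) * (c * RtoC x)))).
  rewrite integrand_eq in HB |- *.
  set (w := Cexp (RtoC (-2) * (c * RtoC x))) in *.
  rewrite (Cexp_opp (v * Clog (1 - w))) in HB |- *.
  set (G := (Cexp (v * RtoC (ln 2)) * (Csinh (a * RtoC x) * Csinh (b * RtoC x) * Cexp (- (v * (c * RtoC x)))))%X) in *.
  pose proof (Cexp_neq0 (v * Clog (1 - w))) as Hne.
  set (W := Cexp (v * Clog (1 - w))) in *.
  replace (G * Cinv W - G * binom_sum v N w)%X with (- ((G * Cinv W) * (binom_sum v N w * W - 1)))%X by (field; exact Hne).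
  rewrite Cabs_opp, Cabs_mul.
  apply Rle_trans with (B * (eps / (B + 1))).
  - apply Rmult_le_compat; try apply Cabs_ge0; assumption.
  - assert ((B + 1) * (eps / (B + 1)) = eps) by (field; lra). lra.
Qed.

Lemma Cpow_2_succ v : Cpow (RtoC 2) (v + 1)%X = (RtoC 2 * Cexp (v * RtoC (ln 2)))%X.
Proof.
  unfold Cpow.
  assert (E : Clog (RtoC 2) = RtoC (ln 2)).
  { rewrite Clog_right_half by (simpl; lra).
    rewrite Cabs_RtoC, Rabs_pos_eq by lra; simpl; unfold Rdiv; rewrite Rmult_0_l, atan_0; reflexivity. }
  rewrite E; replace ((v + 1) * RtoC (ln 2))%X with (v * RtoC (ln 2) + RtoC (ln 2))%X by ring.
  rewrite Cexp_add.
  replace (Cexp (RtoC (ln 2))) with (RtoC 2); [ring|].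
  apply Cplx_eq; simpl; rewrite ?cos_0, ?sin_0, ?exp_ln by lra; ring.
Qed.

Lemma sinh_prim_0 m l a b : 0 < m -> pos_quad m l a b ->
  sinh_prim l a b 0 =
  (RtoC 8 * (l * a * b) / ((l - a - b) * (l - a + b) * (l + a + b) * (l + a - b)))%X.
Proof.
  intros Hm Hq; destruct (pos_quad_neq0 m l a b Hm Hq) as [[H1 H2] [H3 H4]].
  unfold sinh_prim, exp_prim; change (RtoC 0) with Czero.
  replace (- ((l - a - b) * 0))%X with Czero by ring.
  replace (- ((l - a + b) * 0))%X with Czero by ring.
  replace (- ((l + a - b) * 0))%X with Czero by ring.
  replace (- ((l + a + b) * 0))%X with Czero by ring.
  rewrite Cexp_0.
  replace (RtoC 8) with ((1 + 1) * (1 + 1) * (1 + 1))%X by (apply Cplx_eq; simpl; ring).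
  field; tauto.
Qed.

(** Four denominators of order [n] against the numerator [v + 2n] leave a decay of [n^(-3)], so the
    majorant used for the primitives applies here too. *)
Lemma Cabs_hyp_term_le v a b c m : v <> Czero -> 0 < m ->
  (forall n, pos_quad (m * (INR n + 1)) (freq v c n) a b) ->
  exists K, forall n,
    Cabs (binom_coef v n * ((v + RtoC 2 * RtoC (INR n)) / v) * factor_quotient v a b c n)
    <= K * (Cabs (binom_coef v n) / ((INR n + 1) * (INR n + 2) * (INR n + 3))).
Proof.
  intros Hv Hm Hq.
  set (Q := Cabs (v * c - a - b) / m * (Cabs (v * c - a + b) / m) * (Cabs (v * c + a + b) / m) * (Cabs (v * c + a - b) / m)).
  assert (HQ : 0 <= Q).
  { unfold Q; repeat apply Rmult_le_pos; try apply Cabs_ge0; left; apply Rinv_0_lt_compat, Hm. }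
  pose proof (Cabs_gt0 v Hv) as Hv0.
  (* The 6 comes from [(n + 2)(n + 3) <= 6 (n + 1)^2], with equality at [n = 0]. *)
  exists (6 * ((Cabs v + 2) / Cabs v) * Q); intros n; pose proof (pos_INR n) as Hn.
  pose proof (Cabs_factor_quotient_le v a b c m n Hm (Hq n)) as HF; fold Q in HF.
  rewrite !Cabs_mul.
  assert (HV : Cabs ((v + RtoC 2 * RtoC (INR n)) / v) <= (Cabs v + 2) / Cabs v * (INR n + 1)).
  { unfold Cdiv; rewrite Cabs_mul, (Cabs_inv v Hv).
    replace ((Cabs v + 2) / Cabs v * (INR n + 1)) with ((Cabs v + 2) * (INR n + 1) * / Cabs v) by (field; lra).
    apply Rmult_le_compat_r; [left; apply Rinv_0_lt_compat, Hv0|].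
    eapply Rle_trans; [apply Cabs_add|].
    rewrite Cabs_mul, !Cabs_RtoC, !Rabs_pos_eq by lra. nra. }
  set (V := (Cabs v + 2) / Cabs v) in *.
  assert (HV0 : 0 <= V) by (apply Rdiv_le_0_compat; lra).
  pose proof (Cabs_ge0 (binom_coef v n)) as Hb.
  clearbody V Q.
  apply Rle_trans with (Cabs (binom_coef v n) * (V * (INR n + 1)) * (Q / ((INR n + 1) * (INR n + 1) * (INR n + 1) * (INR n + 1)))).
  - apply Rmult_le_compat; [apply Rmult_le_pos; apply Cabs_ge0|apply Cabs_ge0| |exact HF].
    apply Rmult_le_compat_l; assumption.
  - replace (Cabs (binom_coef v n) * (V * (INR n + 1)) * (Q / ((INR n + 1) * (INR n + 1) * (INR n + 1) * (INR n + 1))))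
      with (V * Q * Cabs (binom_coef v n) * / ((INR n + 1) * (INR n + 1) * (INR n + 1))) by (field; lra).
    replace (6 * V * Q * (Cabs (binom_coef v n) / ((INR n + 1) * (INR n + 2) * (INR n + 3))))
      with (V * Q * Cabs (binom_coef v n) * (6 * / ((INR n + 1) * (INR n + 2) * (INR n + 3)))) by (field; lra).
    apply Rmult_le_compat_l; [repeat apply Rmult_le_pos; assumption|].
    pose proof (cube_pochhammer_pos n) as Hcu.
    assert (Hc1 : 0 < (INR n + 1) * (INR n + 1) * (INR n + 1)) by (repeat apply Rmult_lt_0_compat; lra).
    replace (6 * / ((INR n + 1) * (INR n + 2) * (INR n + 3)))
      with (/ ((INR n + 1) * (INR n + 2) * (INR n + 3) / 6)) by (field; lra).
    apply Rinv_le_contravar; [lra|].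
    apply Rmult_le_reg_r with 6; [lra|].
    replace ((INR n + 1) * (INR n + 2) * (INR n + 3) / 6 * 6) with ((INR n + 1) * ((INR n + 2) * (INR n + 3))) by field.
    replace ((INR n + 1) * (INR n + 1) * (INR n + 1) * 6) with ((INR n + 1) * (6 * ((INR n + 1) * (INR n + 1)))) by ring.
    apply Rmult_le_compat_l; nra.
Qed.

Lemma sinh_integral_series (v a b c L : Cplx) (m : R) : Cre v < 3 -> 0 < Cre c -> 0 < m ->
  (forall n, pos_quad (m * (INR n + 1)) (freq v c n) a b) ->
  Cseries_cv (fun n => Cexp (v * RtoC (ln 2)) / RtoC 4 * (binom_coef v n * sinh_prim (freq v c n) a b 0))%X L ->
  improper_integral_0_inf
    (fun x => Csinh (a * RtoC x) * Csinh (b * RtoC x) / sinh_cpow c v x)%X L.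
Proof.
  intros Hv Hc Hm Hq HL.
  destruct (Cabs_sinh_prim_freq v c a b m Hc Hm Hq) as [K HK].
  assert (Hmn : forall n, 0 < m * (INR n + 1)).
  { intros n; apply Rmult_lt_0_compat; [exact Hm|]; pose proof (pos_INR n); lra. }
  (* The numerator is the [2^v] of the inverted complex power; the 4 undoes the factor in the
     derivative of [sinh_prim]. *)
  set (k := (Cexp (v * RtoC (ln 2)) / RtoC 4)%X) in *.
  apply (termwise_improper_integral _
    (fun n x => k * (binom_coef v n * sinh_prim (freq v c n) a b x))%X
    (fun n x => Cexp (v * RtoC (ln 2)) * (Csinh (a * RtoC x) * Csinh (b * RtoC x) * Cexp (- (v * (c * RtoC x))))
        * (binom_coef v n * Cpown (Cexp (RtoC (-2) * (c * RtoC x))) n))%X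
    (fun n => Cabs k * K * (Cabs (binom_coef v n) / ((INR n + 1) * (INR n + 2) * (INR n + 3))))).
  - intros x Hx; apply Cderiv_integrand; assumption.
  - intros n x; eapply Cderiv_eq.
    + apply Cderiv_scal, Cderiv_scal, (Cderiv_sinh_prim _ _ _ _ _ (Hmn n) (Hq n)).
    + rewrite Cexp_freq; unfold k; field. apply RtoC_neq0; lra.
  - intros; apply integrand_expansion; assumption.
  - exact (ex_series_scal (V := R_NormedModule) (Cabs k * K) _ (ex_series_binom_coef v Hv)).
  - intros n x Hx; rewrite !Cabs_mul.
    specialize (HK n x ltac:(lra)); pose proof (cube_pochhammer_pos n).
    replace (Cabs k * K * (Cabs (binom_coef v n) / ((INR n + 1) * (INR n + 2) * (INR n + 3))))
      with (Cabs k * (Cabs (binom_coef v n) * (K / ((INR n + 1) * (INR n + 2) * (INR n + 3)))))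
      by (field; pose proof (pos_INR n); lra).
    do 2 (apply Rmult_le_compat_l; [apply Cabs_ge0|]). exact HK.
  - intros n.
    apply (is_lim_ext (fun x => Cabs k * Cabs (binom_coef v n) * Cabs (sinh_prim (freq v c n) a b x))).
    + intros x; rewrite !Cabs_mul; ring.
    + replace (Finite 0) with (Rbar_mult (Cabs k * Cabs (binom_coef v n)) 0) by (simpl; f_equal; ring).
      apply is_lim_scal_l, (is_lim_sinh_prim _ _ _ _ (Hmn n) (Hq n)).
  - exact HL.
Qed.

Theorem mainTheorem14 (v a b c : Cplx) :
  Cre v < 3 ->
  0 < Cre c ->
  0 < Cre (Cadd (Cadd (Cmul v c) a) b) ->
  0 < Cre (Csub (Cadd (Cmul v c) a) b) ->
  0 < Cre (Cadd (Csub (Cmul v c) a) b) ->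
  0 < Cre (Csub (Csub (Cmul v c) a) b) ->
  let v2 := Cdiv v (RtoC 2) in
  let a2c := Cdiv a (Cmul (RtoC 2) c) in
  let b2c := Cdiv b (Cmul (RtoC 2) c) in
  let s3 := Csub (Csub v2 a2c) b2c in
  let s4 := Cadd (Csub v2 a2c) b2c in
  let s5 := Cadd (Cadd v2 a2c) b2c in
  let s6 := Csub (Cadd v2 a2c) b2c in
  let P := Cmul (Cmul (Cmul (Csub (Csub (Cmul v c) a) b) (Cadd (Cadd (Cmul v c) a) b))
                      (Cadd (Csub (Cmul v c) a) b))
                (Csub (Cadd (Cmul v c) a) b) in
  not_nonpos_int v2 ->
  not_nonpos_int (Cadd Cone s3) ->
  not_nonpos_int (Cadd Cone s4) ->
  not_nonpos_int (Cadd Cone s5) ->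
  not_nonpos_int (Cadd Cone s6) ->
  exists S : Cplx,
    Cseries_cv
      (pFq_term [v; Cadd Cone v2; s3; s5; s4; s6]
                [v2; Cadd Cone s3; Cadd Cone s5; Cadd Cone s4; Cadd Cone s6] Cone) S /\
    improper_integral_0_inf
      (fun x => Cdiv (Cmul (Csinh (Cmul a (RtoC x))) (Csinh (Cmul b (RtoC x))))
                     (sinh_cpow c v x))
      (Cmul (Cdiv (Cmul (Cmul (Cmul (Cmul (Cpow (RtoC 2) (Cadd v Cone)) v) a) b) c) P) S).
Proof.
  intros Hv Hc Hpp Hpm Hmp Hmm v2 a2c b2c s3 s4 s5 s6 P H2 H3 H4 H5 H6.
  pose proof RtoC_2_neq0 as Htwo.
  assert (Hc0 : c <> Czero) by (apply neq0_of_Cre, Hc).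
  (* [v = 0] would make [v / 2] the nonpositive integer [- 0]. *)
  assert (Hv0 : v <> Czero).
  { intros E; apply (H2 0%nat); unfold v2; rewrite E; simpl.
    replace (RtoC (- 0)) with Czero by (unfold Czero; f_equal; ring). field; exact Htwo. }
  destruct (pos_quad_freq v c a b Hc Hmm Hmp Hpm Hpp) as (m & Hm & Hq).
  assert (Hne : forall n, ((freq v c n - a - b)%X <> Czero /\ (freq v c n - a + b)%X <> Czero) /\
    ((freq v c n + a - b)%X <> Czero /\ (freq v c n + a + b)%X <> Czero)).
  { intros n; apply (pos_quad_neq0 (m * (INR n + 1))); [|apply Hq].
    apply Rmult_lt_0_compat; [exact Hm|]; pose proof (pos_INR n); lra. }
  assert (Hterm : forall n, (binom_coef v n * ((v + RtoC 2 * RtoC (INR n)) / v) * factor_quotient v a b c n)%X =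
    pFq_term [v; Cadd Cone v2; s3; s5; s4; s6]
      [v2; Cadd Cone s3; Cadd Cone s5; Cadd Cone s4; Cadd Cone s6] Cone n).
  { intros n; destruct (Hne n) as [[N3 N4] [N6 N5]].
    destruct (ratio_shift c s3 (v * c - a - b)%X _ (RtoC (INR n)) Hc0 N3) as [M3 R3];
      [unfold s3, v2, a2c, b2c; field; tauto|unfold freq; ring|].
    destruct (ratio_shift c s4 (v * c - a + b)%X _ (RtoC (INR n)) Hc0 N4) as [M4 R4];
      [unfold s4, v2, a2c, b2c; field; tauto|unfold freq; ring|].
    destruct (ratio_shift c s5 (v * c + a + b)%X _ (RtoC (INR n)) Hc0 N5) as [M5 R5];
      [unfold s5, v2, a2c, b2c; field; tauto|unfold freq; ring|].
    destruct (ratio_shift c s6 (v * c + a - b)%X _ (RtoC (INR n)) Hc0 N6) as [M6 R6];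
      [unfold s6, v2, a2c, b2c; field; tauto|unfold freq; ring|].
    rewrite (hyp_term_split v v2 s3 s4 s5 s6 n) by assumption.
    rewrite R3, R4, R5, R6.
    replace ((v2 + RtoC (INR n)) / v2)%X with ((v + RtoC 2 * RtoC (INR n)) / v)%X
      by (unfold v2; field; tauto).
    unfold factor_quotient; ring. }
  (* The sum has no closed form to offer as witness: the majorant supplies it, and the series of
     primitives at 0 is then matched termwise with its multiple. *)
  destruct (Cabs_hyp_term_le v a b c m Hv0 Hm Hq) as [K HK].
  destruct (Cseries_cv_dominated _ (fun n => K * (Cabs (binom_coef v n) / ((INR n + 1) * (INR n + 2) * (INR n + 3))))
    (ex_series_scal (V := R_NormedModule) K _ (ex_series_binom_coef v Hv)) HK) as [S HS].
  exists S; split; [exact (Cseries_cv_ext _ _ _ Hterm HS)|].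
  apply (sinh_integral_series v a b c _ m Hv Hc Hm Hq).
  eapply Cseries_cv_ext; [|apply Cseries_cv_scal, HS].
  intros n; cbv beta; destruct (Hne n) as [[N3 N4] [N6 N5]].
  rewrite (sinh_prim_0 (m * (INR n + 1))); [|apply Rmult_lt_0_compat; [exact Hm|]; pose proof (pos_INR n); lra|apply Hq].
  rewrite Cpow_2_succ; unfold factor_quotient, P.
  assert (HP : (((v * c - a - b)%X <> Czero /\ (v * c + a + b)%X <> Czero) /\ ((v * c - a + b)%X <> Czero /\ (v * c + a - b)%X <> Czero)))
    by (repeat split; apply neq0_of_Cre; assumption).
  destruct HP as [[Q3 Q5] [Q4 Q6]].
  replace (RtoC 8) with (RtoC 2 * RtoC 4)%X by (apply Cplx_eq; simpl; ring).
  assert (Hfour : RtoC 4 <> Czero) by (apply RtoC_neq0; lra).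
  (* Naming the linear factors as atoms keeps [field] from multiplying out the denominators. [freq]
     is unfolded only afterwards, which exposes the numerator [l_n = (v + 2n) c] alone. *)
  set (q3 := (v * c - a - b)%X) in *; set (q4 := (v * c - a + b)%X) in *.
  set (q5 := (v * c + a + b)%X) in *; set (q6 := (v * c + a - b)%X) in *.
  set (p3 := (freq v c n - a - b)%X) in *; set (p4 := (freq v c n - a + b)%X) in *.
  set (p5 := (freq v c n + a + b)%X) in *; set (p6 := (freq v c n + a - b)%X) in *.
  unfold freq; clearbody q3 q4 q5 q6 p3 p4 p5 p6; field; tauto.
Qed.
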